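(* Let $k\ge 1$, let $n_1,\dots,n_k$ and $d_1,\dots,d_k$ be positive integers, and let $X=\nu_{d_1,\dots,d_k}(\mathbb{P}^{n_1}\times\cdots\times\mathbb{P}^{n_k})\subset\mathbb{P}^N$ be the Segre-Veronese variety. Then every point $p\in\sigma_3(X)$ satisfies $$r_X(p)\le -1+\sum_{i=1}^k 2d_i .$$
   Context: Work over an algebraically closed field $K$. $\nu_{d_1,\dots,d_k}:\mathbb{P}^{n_1}\times\cdots\times\mathbb{P}^{n_k}\to\mathbb{P}^N$, $N=\prod_{i=1}^k\binom{d_i+n_i}{n_i}-1$, is the Segre-Veronese embedding given by the complete linear system $|\mathcal{O}(d_1,\dots,d_k)|$; its image $X$ is the set of classes of partially symmetric tensors $v_1^{\otimes d_1}\otimes\cdots\otimes v_k^{\otimes d_k}$ in $\mathbb{P}(S^{d_1}V_1\otimes\cdots\otimes S^{d_k}V_k)$, $\mathbb{P}(V_i)=\mathbb{P}^{n_i}$. The $s$-th secant variety $\sigma_s(X)$ is the Zariski closure of the union of all linear spaces $\mathbb{P}^{s-1}$ spanned by $s$ points of $X$. The $X$-rank $r_X(p)$ of $p\in\mathbb{P}^N$ is the minimal $s$ such that $p$ lies in the linear span of $s$ points of $X$. *)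

(* Defs.v *)
From HB Require Import structures.
From mathcomp Require Import all_boot all_order all_algebra.
Set Implicit Arguments. Unset Strict Implicit. Unset Printing Implicit Defensive.
Import GRing.Theory.
Local Open Scope ring_scope.

Definition mon (n d : nat) :=
  {f : {ffun 'I_n.+1 -> 'I_d.+1} | (\sum_(j < n.+1) (f j : nat))%N == d}.

(* Coordinates of P^N = P(S^{d_1}V_1 (x) ... (x) S^{d_k}V_k): multi-indices
   given by one monomial of degree d_i in n_i+1 variables for each factor. *)
Definition SVidx (k : nat) (n d : 'I_k -> nat) :=
  {dffun forall i : 'I_k, mon (n i) (d i)}.

(* Affine representative of the Segre-Veronese embedding (complete linear
   system |O(d_1,...,d_k)|, monomial basis). *)
Definition segre_veronese (K : fieldType) (k : nat) (n d : 'I_k -> nat)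
  (v : forall i : 'I_k, 'I_(n i).+1 -> K) : SVidx n d -> K :=
  fun a => \prod_(i < k) \prod_(j < (n i).+1) v i j ^+ (val (a i) j : nat).

Definition span_of_pts (K : fieldType) (k : nat) (n d : 'I_k -> nat)
  (s : nat) (p : SVidx n d -> K) : Prop :=
  exists (c : 'I_s -> K) (v : 'I_s -> forall i : 'I_k, 'I_(n i).+1 -> K),
    (forall (j : 'I_s) (i : 'I_k), exists t, v j i t <> 0) /\
    p = (fun a => \sum_(j < s) c j * segre_veronese (v j) a).

Definition X_rank_le (K : fieldType) (k : nat) (n d : 'I_k -> nat)
  (p : SVidx n d -> K) (b : nat) : Prop :=
  exists s : nat, (s <= b)%N /\ span_of_pts s p.

Inductive polyfun (K : fieldType) (T : Type) : ((T -> K) -> K) -> Prop :=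
| pf_const (c : K) : polyfun (fun _ => c)
| pf_coord (t : T) : polyfun (fun x => x t)
| pf_add f g : polyfun f -> polyfun g -> polyfun (fun x => f x + g x)
| pf_mul f g : polyfun f -> polyfun g -> polyfun (fun x => f x * g x).

Definition zariski_closure (K : fieldType) (T : Type) (S : (T -> K) -> Prop)
  (p : T -> K) : Prop :=
  forall f, polyfun f -> (forall x, S x -> f x = 0) -> f p = 0.

Definition secant_cone (K : fieldType) (k : nat) (n d : 'I_k -> nat)
  (s : nat) : (SVidx n d -> K) -> Prop :=
  zariski_closure (fun q => span_of_pts s q).

(* Main.v *)
(** A point of [sigma_3(X)] is a specialization, along a place, of a sum
    [c1 x1 + c2 x2 + c3 x3] of three points of [X] over a larger field. Let [D]
    be the sum of the [d_i]. If the coefficients specialize too, three points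
    suffice. Otherwise, by clearing the poles, the specialization is one of
    - a tangent vector at a point of [X] plus a multiple of another point:
      [D + 2] points, by interpolation on a rational curve of degree [D];
    - a functional of order two at a point of the image of a curve which is a
      conic in each factor: this curve has degree [2D], and Sylvester's algorithm
      for binary forms of degree [2D] gives [2D - 1] points;
    - [c (x) w + a (x) D_x w + b (x) D_y w], with [c], [a], [b] in a factor of
      degree one: interpolation on two rational curves of degree [D - 1] through
      their common point [w] gives [2(D - 1) + 1] points.
    When [D = 2] the first two are symmetric or general matrices of rank at most
    three. Everything is independent of the characteristic. *)

Require Import Defs.
From HB Require Import structures.
From mathcomp Require Import all_boot all_order all_algebra.
From mathcomp Require Import separable boolp classical_sets functions filter.
From mathcomp Require Import ring zify.
Set Implicit Arguments. Unset Strict Implicit. Unset Printing Implicit Defensive.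
Import GRing.Theory.
Local Open Scope ring_scope.

(** * Extension of places *)

(** A place replaces a one-parameter degeneration: no dimension theory or choice of a curve is
    required, and the only valuative input is that of two elements one divides the other. The
    obstacle is that coefficients may have poles which cancel only in the sum. They are controlled
    by testing the sum on few coordinates: all slots where normalized vectors equal 1, then one or
    two slots changed. If two distinct slots separate a point from each of the other two, a product
    of two linear forms isolates its term, so its coefficient is finite. A pole therefore forces the
    point either to have the same reduction as another one in every factor, or to be separated from
    the others in a single factor of degree one; the normal forms come from this alternative.
    Derivatives occur only as coefficients of polynomials, which is why no factorial is ever
    inverted. *)

Record is_place (F K : fieldType) (O : F -> Prop) (res : F -> K) : Prop := IsPlace {
  place1 : O 1;
  placeB : forall x y, O x -> O y -> O (x - y);
  placeM : forall x y, O x -> O y -> O (x * y);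
  res1 : res 1 = 1;
  resB : forall x y, O x -> O y -> res (x - y) = res x - res y;
  resM : forall x y, O x -> O y -> res (x * y) = res x * res y;
  placeV : forall x, ~ O x -> O x^-1 /\ res x^-1 = 0 }.

Section PlaceExtension.
Variables (F : fieldType) (K : closedFieldType).
Local Notation FK := (F * K)%type.
Local Open Scope classical_set_scope.

(* A homomorphism from a subring of [F] to [K] is represented by its graph. *)
Definition partial_hom (G : set FK) : Prop :=
  [/\ G 1, (forall u v, G u -> G v -> G (u - v)),
      (forall u v, G u -> G v -> G (u * v)) &
      forall u, G u -> u.1 = 0 -> u.2 = 0].

(** * Maximal partial homomorphisms and their valuation rings *)

Section Maximal.
Variable G : set FK.
Hypothesis homG : partial_hom G.
Hypothesis constG : forall c, exists x, G (x, c).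
Hypothesis maxG : forall G', G `<=` G' -> partial_hom G' -> G' `<=` G.

Let G1 : G 1. Proof. by case: homG. Qed.
Let GB u v : G u -> G v -> G (u - v). Proof. by case: homG => _ + _ _; apply. Qed.
Let GM u v : G u -> G v -> G (u * v). Proof. by case: homG => _ _ + _; apply. Qed.
Let Gf u : G u -> u.1 = 0 -> u.2 = 0. Proof. by case: homG => _ _ _; apply. Qed.
Let G0 : G 0. Proof. by rewrite -(subrr 1); apply: GB. Qed.
Let GN u : G u -> G (- u). Proof. by move=> Gu; rewrite -sub0r; apply: GB. Qed.
Let GD u v : G u -> G v -> G (u + v).
Proof. by move=> Gu Gv; rewrite -(opprK v); apply: GB => //; apply: GN. Qed.
Let GX u n : G u -> G (u ^+ n).
Proof. by move=> Gu; elim: n => [|n IH]; rewrite ?expr0 // exprS; apply: GM. Qed.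
Let Gsum (I : Type) (r : seq I) (P : pred I) (f : I -> FK) :
  (forall i, P i -> G (f i)) -> G (\sum_(i <- r | P i) f i).
Proof. by move=> Gf'; elim/big_ind: _. Qed.

Let coefG (P : {poly FK}) := forall i, G P`_i.
Let P1 (P : {poly FK}) : {poly F} := map_poly fst P.
Let P2 (P : {poly FK}) : {poly K} := map_poly snd P.

Let coefGB P Q : coefG P -> coefG Q -> coefG (P - Q).
Proof. by move=> GP GQ i; rewrite coefB; apply: GB. Qed.
Let coefGM P Q : coefG P -> coefG Q -> coefG (P * Q).
Proof. by move=> GP GQ i; rewrite coefM; apply: Gsum => j _; apply: GM. Qed.
Let coefGC u : G u -> coefG u%:P.
Proof. by move=> Gu i; rewrite coefC; case: ifP. Qed.
Let coefGXn n : coefG 'X^n.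
Proof. by move=> i; rewrite coefXn; case: eqP. Qed.

(** The hypothesis makes [P(x) |-> P(a)] well defined on the ring generated by [x]; by maximality
    this extension adds nothing. *)
Lemma maximal_hom_extend (x : F) (a : K) :
  (forall P, coefG P -> (P1 P).[x] = 0 -> (P2 P).[a] = 0) -> G (x, a).
Proof.
move=> vanish.
pose G' := [set u : FK | exists2 P, coefG P & u = ((P1 P).[x], (P2 P).[a])].
have sub : G `<=` G'.
  move=> [u v] Guv; exists (u, v)%:P; first exact: coefGC.
  by rewrite /P1 /P2 !map_polyC /= !hornerC.
apply: (maxG sub); last first.
  exists 'X; first by rewrite -['X]expr1; apply: coefGXn.
  by rewrite /P1 /P2 !map_polyX !hornerX.
split.
- exact: sub.
- move=> _ _ [P GP ->] [Q GQ ->]; exists (P - Q); first exact: coefGB.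
  by rewrite /P1 /P2 !rmorphB /= !hornerE.
- move=> _ _ [P GP ->] [Q GQ ->]; exists (P * Q); first exact: coefGM.
  by rewrite /P1 /P2 !rmorphM /= !hornerE.
- by move=> _ [P GP ->] /=; apply: vanish.
Qed.

(** The maximal ring is local: multiplying an equation of the inverse by a power of [u] turns it
    into an element of [G], and the power of [u.2] cancels after reduction. *)
Lemma maximal_hom_local u : G u -> u.2 != 0 -> G (u.1^-1, u.2^-1).
Proof.
move=> Gu nz2; have nz1 : u.1 != 0 by apply: contra_neq nz2; apply: Gf.
apply: maximal_hom_extend => P GP; set n := size P.
have rev (L : fieldType) (f : {rmorphism FK -> L}) : f u != 0 ->
    f (\sum_(i < n) P`_i * u ^+ (n - i)) = f u ^+ n * (map_poly f P).[(f u)^-1].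
  move=> nz; rewrite (@horner_coef_wide _ n) ?size_poly //.
  rewrite rmorph_sum mulr_sumr; apply: eq_bigr => i _.
  rewrite coef_map rmorphM rmorphXn /= [RHS]mulrCA; congr (_ * _).
  by rewrite exprVn expfB.
move=> vanish; have := Gf (u := \sum_(i < n) P`_i * u ^+ (n - i)).
rewrite (rev _ fst nz1) (rev _ snd nz2) -/(P1 P) -/(P2 P) vanish mulr0.
have GS : G (\sum_(i < n) P`_i * u ^+ (n - i)).
  by apply: Gsum => i _; apply: GM => //; apply: GX.
by move/(_ GS erefl)/eqP; rewrite mulf_eq0 expf_eq0 (negbTE nz2) andbF => /eqP.
Qed.

(* [x] cannot be given a value exactly when it satisfies such an equation:
   otherwise the reduced equations of [x] form a proper ideal of [K[X]]. *)
Let unital x P := [/\ coefG P, (P1 P).[x] = 0 & P2 P = 1].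

Lemma maximal_hom_unital x : (exists a, G (x, a)) \/ exists P, unital x P.
Proof.
case: (pselect (exists P, unital x P)) => [?|noP]; first by right.
left; pose I g := exists P, [/\ coefG P, (P1 P).[x] = 0 & P2 P = g].
suff [a ra] : exists a, forall g, I g -> g.[a] = 0.
  by exists a; apply: maximal_hom_extend => P GP Px; apply: ra; exists P.
case: (pselect (exists2 g, I g & g != 0)) => [|all0]; last first.
  exists 0 => g Ig; have [->|nzg] := eqVneq g 0; first by rewrite horner0.
  by case: all0; exists g.
move=> [g0 Ig0 nz0].
(* A nonzero element of [I] of least degree divides all the others by Euclidean division; it is not
   constant, since no equation is unital, so it has a root. *)
have exn : exists n, `[< exists g, [/\ I g, g != 0 & size g = n] >].
  by exists (size g0); apply/asboolP; exists g0.
case: (ex_minnP exn) => n /asboolP[g [Ig nzg szg]] min_n.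
have IB g1 g2 : I g1 -> I g2 -> I (g1 - g2).
  move=> [P [GP Px <-]] [Q [GQ Qx <-]]; exists (P - Q); split.
  - exact: coefGB.
  - by rewrite /P1 rmorphB /= hornerD hornerN -/(P1 P) -/(P1 Q) Px Qx subr0.
  - by rewrite /P2 rmorphB.
have IM g1 g2 : I g2 -> I (g1 * g2).
  move=> [Q [GQ Qx <-]].
  pose lift c := xget 0 [set u : FK | G u /\ u.2 = c].
  have liftP c : G (lift c) /\ (lift c).2 = c.
    have [y Gy] := constG c.
    by apply: (@xgetPex _ 0 [set u : FK | G u /\ u.2 = c]); exists (y, c).
  pose R : {poly FK} := \poly_(i < size g1) lift g1`_i.
  have GR : coefG R.
    by move=> i; rewrite coef_poly; case: ifP => // _; case: (liftP g1`_i).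
  have R2 : P2 R = g1.
    apply/polyP => i; rewrite /P2 coef_map coef_poly; case: ltnP => [_|szi].
      by case: (liftP g1`_i).
    by rewrite /= nth_default.
  exists (R * Q); split; first exact: coefGM.
  - by rewrite /P1 rmorphM /= hornerM -/(P1 Q) Qx mulr0.
  - by rewrite /P2 rmorphM /= -/(P2 R) R2.
have : size g != 1%N.
  apply/negP => /size_poly1P[c nzc gc]; apply: noP.
  have [P [GP Px P2g]] : I (c^-1%:P * g) by apply: IM.
  by exists P; split=> //; rewrite P2g gc -polyCM mulVf.
case/closed_rootP => a ga; exists a => h Ih.
have [r0|nzr] := eqVneq (h %% g) 0.
  by rewrite (divp_eq h g) r0 addr0 hornerM (rootP ga) mulr0.
have Ir : I (h %% g).
  have -> : h %% g = h - (h %/ g) * g by rewrite {2}(divp_eq h g) addrC addKr.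
  by apply: IB => //; apply: IM.
have : (n <= size (h %% g)%R)%N by apply: min_n; apply/asboolP; exists (h %% g).
by rewrite leqNgt -szg ltn_modp nzg.
Qed.

(** Chevalley's descent. The constant coefficient of [Q] reduces to 1, hence is invertible, so a
    multiple of the reversed [Q], which vanishes at [x], cancels the leading term of [P]. The
    leading coefficient of [P] reduces to 0, hence so does the multiplier [e], and the reduction of
    [P] is unchanged. *)
Lemma maximal_hom_reduce x P Q : x != 0 -> unital x P -> unital x^-1 Q ->
  (size Q <= size P)%N -> exists2 P', unital x P' & (size P' < size P)%N.
Proof.
move=> nzx [GP Px P2e] [GQ Qx Q2e] szQP.
have coef0 (R : {poly FK}) : P2 R = 1 -> (R`_0).2 = 1.
  by move/polyP/(_ 0%N); rewrite coef_map coefC.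
have coefS (R : {poly FK}) i : P2 R = 1 -> (R`_i.+1).2 = 0.
  by move/polyP/(_ i.+1); rewrite coef_map coefC.
have nzQ0 : (Q`_0).1 != 0.
  by apply/eqP => /(Gf (GQ 0%N)) /eqP; rewrite coef0 // oner_eq0.
have szQ : (0 < size Q)%N.
  rewrite lt0n size_poly_eq0; apply/eqP => Q0.
  by move/eqP: Q2e; rewrite Q0 /P2 rmorph0 eq_sym oner_eq0.
have [m szQm] : exists m, size Q = m.+1 by exists (size Q).-1; rewrite prednK.
have szP : (1 < size P)%N.
  rewrite ltnNge; apply/negP => szP1.
  have nzP0 : (P`_0).1 != 0.
    by apply/eqP => /(Gf (GP 0%N)) /eqP; rewrite coef0 // oner_eq0.
  by case/eqP: nzP0; move: Px; rewrite /P1 {1}(size1_polyC szP1) map_polyC hornerC.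
have [n szPn] : exists n, size P = n.+2.
  by case: (size P) szP => [|[|n]] // _; exists n.
have [e [Ge e2 eQ0]] : exists e : FK, [/\ G e, e.2 = 0 & e * Q`_0 = P`_n.+1].
  exists (P`_n.+1 * ((Q`_0).1^-1, (Q`_0).2^-1)); split.
  - apply: GM => //; apply: maximal_hom_local => //.
    by rewrite coef0 // oner_eq0.
  - by rewrite /= coefS // mul0r.
  - rewrite -mulrA [X in _ * X](_ : _ = 1) ?mulr1 //.
    by congr pair; rewrite /= mulVf // coef0 ?oner_eq0.
pose R : {poly FK} := \poly_(i < m.+1) Q`_(m - i).
have GR : coefG R by move=> i; rewrite coef_poly; case: ifP.
have mn : (m <= n.+1)%N by rewrite -ltnS -szQm -szPn.
pose P' := P - e%:P * R * 'X^(n.+1 - m).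
have R1x : (P1 R).[x] = x ^+ m * (P1 Q).[x^-1].
  rewrite (@horner_coef_wide _ m.+1) ?(leq_trans (size_poly _ _)) ?size_poly //.
  rewrite (@horner_coef_wide _ m.+1 (P1 Q)) -?szQm ?size_poly // szQm.
  rewrite mulr_sumr (reindex_inj rev_ord_inj) /=; apply: eq_bigr => i _.
  have im : (i <= m)%N by rewrite -ltnS.
  rewrite /P1 !coef_map coef_poly /= !subSS ltnS leq_subr subKn //.
  rewrite [RHS]mulrCA; congr (_ * _).
  by rewrite exprVn expfB_cond // (negbTE nzx).
exists P'; first split.
- by apply: coefGB => //; apply: coefGM => //; apply: coefGM => //; apply: coefGC.
- rewrite /P1 rmorphB !rmorphM /= !hornerE -/(P1 P) -/(P1 R) Px R1x Qx.
  by rewrite mulr0 mulr0 mul0r subr0.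
- rewrite /P2 rmorphB !rmorphM /= map_polyC /= e2 -/(P2 P) P2e.
  by rewrite polyC0 !mul0r subr0.
rewrite szPn; apply/leq_sizeP => j; rewrite leq_eqVlt => /orP[/eqP <-|jn].
  rewrite /P' coefB coefMXn ltnNge leq_subr /= subKn // coefCM coef_poly ltnSn subnn.
  by rewrite eQ0 subrr.
rewrite /P' coefB nth_default ?szPn // coefMXn.
rewrite ltnNge (leq_trans (leq_subr _ _) (ltnW jn)) /= coefCM coef_poly.
by rewrite ltnS leqNgt ltn_subRL subnK // jn /= mulr0 subr0.
Qed.

Lemma maximal_hom_valuation x : (exists a, G (x, a)) \/ exists a, G (x^-1, a).
Proof.
have [->|nzx] := eqVneq x 0; first by left; exists 0.
suff no y P Q : y != 0 -> unital y P -> unital y^-1 Q -> False.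
  have [?|[P uP]] := maximal_hom_unital x; first by left.
  have [?|[Q uQ]] := maximal_hom_unital x^-1; first by right.
  by case: (no x P Q).
move: {2}(size P + size Q)%N (leqnn (size P + size Q)%N) => N.
elim: N y P Q => [|N IH] y P Q leN nzy uP uQ.
  have : P = 0 by apply/eqP; rewrite -size_poly_eq0 -leqn0 (leq_trans _ leN) ?leq_addr.
  by case: uP => _ _ + P0; rewrite P0 /P2 rmorph0 => /eqP; rewrite eq_sym oner_eq0.
case: (leqP (size Q) (size P)) => [sz|/ltnW sz].
  have [P' uP' ltP] := maximal_hom_reduce nzy uP uQ sz.
  by apply: (IH y P' Q) => //; rewrite -ltnS (leq_trans _ leN) // ltn_add2r.
have nzy' : y^-1 != 0 by rewrite invr_eq0.
rewrite -{1}[y]invrK in uP.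
have [Q' uQ' ltQ] := maximal_hom_reduce nzy' uQ uP sz.
rewrite invrK in uP.
by apply: (IH y P Q') => //; rewrite -ltnS (leq_trans _ leN) // ltn_add2l.
Qed.

Lemma maximal_hom_place : exists (O : F -> Prop) (res : F -> K),
  is_place O res /\ forall x a, G (x, a) -> O x /\ res x = a.
Proof.
pose O x := exists a, G (x, a).
pose res x := xget 0 [set a | G (x, a)].
have resE x a : G (x, a) -> res x = a.
  move=> Gxa; apply: xget_unique => // b Gxb.
  have := Gf (GB Gxb Gxa); rewrite /= subrr => /(_ erefl) /eqP.
  by rewrite subr_eq0 => /eqP.
exists O, res; split; last by move=> x a Gxa; split; [exists a | exact: resE].
have resP x : O x -> G (x, res x) by move=> [a Gxa]; rewrite (resE x a).
split.
- by exists 1.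
- by move=> x y [a Ga] [b Gb]; exists (a - b); apply: (GB Ga Gb).
- by move=> x y [a Ga] [b Gb]; exists (a * b); apply: (GM Ga Gb).
- exact: resE.
- by move=> x y /resP Ga /resP Gb; apply: resE; apply: (GB Ga Gb).
- by move=> x y /resP Ga /resP Gb; apply: resE; apply: (GM Ga Gb).
- move=> x nOx; have [//|[a Ga]] := maximal_hom_valuation x.
  split; first by exists a.
  rewrite (resE _ _ Ga); apply: contra_notP nOx => /eqP nza.
  by have := maximal_hom_local Ga nza; rewrite /= invrK; exists a^-1.
Qed.

End Maximal.

Lemma place_extension (G0 : set FK) : partial_hom G0 ->
  (forall c, exists x, G0 (x, c)) ->
  exists (O : F -> Prop) (res : F -> K),
  is_place O res /\ forall x a, G0 (x, a) -> O x /\ res x = a.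
Proof.
move=> hom0 const0.
pose P (G : set FK) := G = set0 \/ G0 `<=` G /\ partial_hom G.
have [|G [PG maxG]] := @Zorn_bigcup _ P.
  move=> C PC totC.
  case: (pselect (exists2 G, C G & G !=set0)) => [[G CG neG]|allE]; last first.
    left; rewrite predeqE => u; split=> // -[G CG Gu]; case: allE.
    by exists G => //; exists u.
  have good H u : C H -> H u -> G0 `<=` H /\ partial_hom H.
    by move=> CH Hu; case: (PC _ CH) => // H0; rewrite H0 in Hu.
  have [u0 Gu0] := neG; have [sG homG] := good _ _ CG Gu0.
  right; split; first by move=> u /sG; exists G.
  have common u v : (\bigcup_(X in C) X) u -> (\bigcup_(X in C) X) v ->
      exists H, [/\ C H, H u, H v & partial_hom H].
    move=> [H CH Hu] [H' CH' Hv]; case: (totC _ _ CH CH') => sub.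
      by exists H'; split=> //; [apply: sub | case: (good _ _ CH' Hv)].
    by exists H; split=> //; [apply: sub | case: (good _ _ CH Hu)].
  split.
  - by exists G => //; case: homG.
  - move=> u v Cu Cv; have [H [CH Hu Hv [_ HB _ _]]] := common u v Cu Cv.
    by exists H => //; apply: HB.
  - move=> u v Cu Cv; have [H [CH Hu Hv [_ _ HM _]]] := common u v Cu Cv.
    by exists H => //; apply: HM.
  - move=> u Cu; have [H [CH Hu _ [_ _ _]]] := common u u Cu Cu.
    exact.
have G01 : G0 1 by case: hom0.
have [sG homG] : G0 `<=` G /\ partial_hom G.
  case: PG => // G_0; case: (maxG G0); last by right; split.
  rewrite G_0; split; first by move=> ? [].
  by move=> /(_ 1 G01).
have [||O [res [pl resP]]] := @maximal_hom_place G homG.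
- by move=> c; have [x Gx] := const0 c; exists x; apply: sG.
- move=> G' GG' hom' u G'u; apply: contrapT => nGu.
  apply: (maxG G'); first by split=> // /(_ _ G'u).
  by right; split=> //; apply: subset_trans GG'.
- by exists O, res; split=> // x a /sG /resP.
Qed.

End PlaceExtension.

(** * Limit points as specializations *)

Section Ultrapower.
Local Open Scope classical_set_scope.

(** Quotient of the functions by those vanishing on a member of [U]. A function outside this ideal
    is nonzero on a member of [U], so its pointwise inverse, with [0^-1 = 0], inverts it modulo the
    ideal. *)
Lemma ultrapower (K : fieldType) (X : Type) (U : set_system X) :
  UltraFilter U ->
  exists (F : fieldType) (cl : (X -> K) -> F),
    [/\ cl (fun=> 1) = 1,
        forall f g, cl (fun x => f x + g x) = cl f + cl g,
        forall f g, cl (fun x => f x * g x) = cl f * cl g &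
        forall f, cl f = 0 <-> U (fun x => f x = 0)].
Proof.
move=> ultraU; have [x0 _] := filter_ex (filterT : U setT).
pose XP : pointedType :=
  HB.pack X (gen_eqMixin X) (gen_choiceMixin X) (isPointed.Build X x0).
pose A : comNzRingType := (XP -> K)%type.
pose I : {pred A} := fun f => `[< U [set x : X | f x = 0] >].
have IP (f : A) : reflect (U [set x : X | f x = 0]) (f \in I) by apply: asboolP.
have I_ideal : idealr_closed I.
  split.
  - by apply/IP; apply: filterS filterT => x _.
  - apply/IP => U0; have [x /eqP] := filter_ex U0.
    by rewrite [X in X == _]/(1 : K) oner_eq0.
  - move=> f u v /IP Uu /IP Uv; apply/IP; apply: filterS (filterI Uu Uv).
    move=> x [/= u0 v0]; rewrite -[LHS]/(f x * u x + v x).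
    by rewrite u0 v0 mulr0 addr0.
pose IaM := GRing.isZmodClosed.Build _ I (idealr_closedB I_ideal).
pose IpM := isProperIdeal.Build _ I (idealr_closed_nontrivial I_ideal).
pose Iid : idealr A := HB.pack I IaM IpM.
pose E : comNzRingType := {ideal_quot Iid}.
pose cl : {rmorphism A -> E} := \pi_E%qT.
have cl0 (f : A) : (cl f = 0) <-> U [set x : X | f x = 0].
  have clI : (cl f == 0) = (f \in I) by rewrite piE Quotient.equivE subr0.
  split=> [/eqP|Uf]; first by rewrite clI => /IP.
  by apply/eqP; rewrite clI; apply/IP.
pose inv (z : E) : E := cl (fun x => (repr z x)^-1).
have clK z : cl (repr z) = z by exact: reprK.
have inv0 : inv 0 = 0.
  apply/cl0; have /cl0 : cl (repr (0 : E)) = 0 by rewrite clK.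
  by apply: filterS => x /= ->; rewrite invr0.
have mulV z : z != 0 -> inv z * z = 1.
  move=> nz; rewrite -{2}(clK z) -rmorphM; apply/eqP.
  rewrite -subr_eq0 -(rmorph1 cl) -rmorphB; apply/eqP/cl0.
  have [U0|Un0] := in_ultra_setVsetC [set x | repr z x = 0] ultraU.
    by case/eqP: nz; rewrite -[z]clK; apply/cl0.
  apply: filterS Un0 => x /= /eqP nzx.
  by rewrite -[LHS]/((repr z x)^-1 * repr z x - 1) mulVf ?subrr.
pose fieldM := GRing.ComNzRing_isField.Build E mulV inv0.
pose F : fieldType := HB.pack E fieldM.
exists F, cl; split.
- exact: (rmorph1 cl).
- by move=> f g; apply: (rmorphD cl).
- by move=> f g; apply: (rmorphM cl).
- exact: cl0.
Qed.

(* A nonarchimedean substitute for "[p] is a limit of points of [S]": the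
   coordinate functions on [S] generate a generic point of an ultrapower, which
   a place specializes to [p]. *)
Lemma zariski_closure_place (K : closedFieldType) (T : Type)
    (S : (T -> K) -> Prop) (p : T -> K) :
  zariski_closure S p ->
  exists (F : fieldType) (cl : ((T -> K) -> K) -> F) (O : F -> Prop)
         (res : F -> K),
    [/\ [/\ cl (fun=> 1) = 1,
            forall f g, cl (fun x => f x + g x) = cl f + cl g,
            forall f g, cl (fun x => f x * g x) = cl f * cl g &
            forall f g, (forall x, S x -> f x = g x) -> cl f = cl g],
        is_place O res &
        forall t, O (cl (fun x => x t)) /\ res (cl (fun x => x t)) = p t].
Proof.
move=> clSp.
(* The filter generated by the traces on [S] of the basic Zariski neighbourhoods of [p]; it is
   proper because [p] lies in the closure. *)
pose B : set_system (T -> K) := [set A | exists f,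
  [/\ polyfun f, f p != 0 & forall x, S x -> f x != 0 -> A x]].
have FB : ProperFilter B.
  apply: Build_ProperFilter_ex.
    move=> A [f [pf nz fA]]; apply: contrapT => noA; case/eqP: nz.
    apply: clSp => // x Sx; apply/eqP; apply: contra_notT noA => nz.
    by exists x; apply: fA.
  split.
  - by exists (fun=> 1); split=> //; [exact: pf_const | exact: oner_neq0].
  - move=> A A' [f [pf nf fA]] [g [pg ng gA]]; exists (fun x => f x * g x).
    split; [exact: pf_mul | exact: mulf_neq0 |].
    move=> x Sx; rewrite mulf_eq0 negb_or => /andP[fx gx].
    by split; [apply: fA | apply: gA].
  - move=> A A' sub [f [pf nf fA]]; exists f; split=> // x Sx nz.
    by apply: sub; apply: fA.
have [U [UU sBU]] := ultraFilterLemma FB.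
have [F [cl [cl1 clD clM cl0]]] := ultrapower K UU.
have US : U S by apply: sBU; exists (fun=> 1); split=> //;
  [exact: pf_const | exact: oner_neq0].
have clN f : cl (fun x => - f x) = - cl f.
  apply/eqP; rewrite -addr_eq0 -clD; apply/eqP/cl0.
  by apply: filterS filterT => x _; rewrite addNr.
have clE f g : (forall x, S x -> f x = g x) -> cl f = cl g.
  move=> fg; apply/eqP; rewrite -subr_eq0 -clN -clD; apply/eqP/cl0.
  by apply: filterS US => x /fg ->; rewrite subrr.
(* The map [cl f |-> f p] is well defined: if [f p] were nonzero, [f] would be nonzero on a member
   of [U]. *)
pose G0 : set (F * K) := [set u | exists2 f, polyfun f & u = (cl f, f p)].
have hom0 : partial_hom G0.
  split.
  - by exists (fun=> 1); [exact: pf_const | rewrite cl1].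
  - move=> _ _ [f pf ->] [g pg ->]; exists (fun x => f x + (-1) * g x).
      by apply: pf_add => //; apply: pf_mul => //; apply: pf_const.
    have -> : (cl f, f p) - (cl g, g p) = (cl f - cl g, f p - g p) by [].
    rewrite clD -clN mulN1r; congr (_ + _, _).
    by apply: clE => x _; rewrite mulN1r.
  - move=> _ _ [f pf ->] [g pg ->]; exists (fun x => f x * g x).
      exact: pf_mul.
    by rewrite clM.
  - move=> _ [f pf ->] /= /cl0 Uf0; apply/eqP; apply/negP => /negP nz.
    have Unz : U (fun x => f x != 0) by apply: sBU; exists f.
    by have [x [/eqP]] := filter_ex (filterI Uf0 Unz); rewrite /= => ->.
have [|O [res [pl resP]]] := place_extension hom0.
  by move=> c; exists (cl (fun=> c)), (fun=> c) => //; exact: pf_const.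
exists F, cl, O, res; split=> // t.
by apply: resP; exists (fun x => x t) => //; exact: pf_coord.
Qed.

End Ultrapower.

(** * Functionals on univariate polynomials *)

Section Univariate.

(** Lagrange interpolation. It turns a derivative along a rational curve into a combination of
    points of that curve. *)
Lemma coef_interpolation (K : fieldType) (zs : seq K) (l : nat) : uniq zs ->
  exists lam : K -> K, forall f : {poly K}, (size f <= size zs)%N ->
    f`_l = \sum_(z <- zs) lam z * f.[z].
Proof.
move=> uz; pose N z : {poly K} := \prod_(y <- rem z zs) ('X - y%:P).
exists (fun z => (N z)`_l / (N z).[z]) => f szf.
have Nz y z : y \in zs -> z \in zs -> ((N z).[y] == 0) = (y != z).
  move=> yz zz; rewrite -rootE root_prod_XsubC.
  by rewrite (rem_filter z uz) mem_filter /= yz andbT.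
have sN z : z \in zs -> size (N z) = size zs.
  by move=> zz; rewrite size_prod_XsubC size_rem // prednK //; case: (zs) zz.
pose g := \sum_(z <- zs) (f.[z] / (N z).[z]) *: N z.
suff fg : f = g.
  by rewrite {1}fg coef_sum; apply: eq_bigr => z _; rewrite coefZ; ring.
apply/eqP; rewrite -subr_eq0; apply/eqP; apply: (@roots_geq_poly_eq0 _ _ zs) => //.
  apply/allP => y yz; rewrite rootE !hornerE horner_sum (bigD1_seq y) //=.
  rewrite big1_seq ?addr0 => [|z /andP[zy zz]].
    by rewrite hornerZ divfK ?subrr // Nz ?eqxx.
  by rewrite hornerZ (eqP (_ : (N z).[y] == 0)) ?mulr0 // Nz // eq_sym.
rewrite (leq_trans (size_polyD _ _)) // geq_max szf size_polyN /=.
rewrite /g big_seq; apply: (leq_trans (size_sum _ _ _)).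
by apply/bigmax_leqP_seq => z zz _; rewrite (leq_trans (size_scale_leq _ _)) ?sN.
Qed.

Variable K : closedFieldType.

(** For a nonempty list, a root of [1 + \prod (X - a)] lies outside it. *)
Lemma closed_field_fresh (s : seq K) : exists x, x \notin s.
Proof.
have [P0|] := boolP (nilp s); first by exists 0; rewrite (nilP P0).
rewrite /nilp => nz; pose P := \prod_(a <- s) ('X - a%:P) : {poly K}.
have szP : size (P + 1) = (size s).+1.
  by rewrite size_polyDl size_prod_XsubC // size_poly1 ltnS lt0n.
have /closed_rootP[x rx] : size (P + 1) != 1%N by rewrite szP eqSS.
exists x; apply/negP => xs; move: rx; rewrite rootE hornerD hornerC.
have /eqP -> : P.[x] == 0 by rewrite -rootE root_prod_XsubC.
by rewrite add0r oner_eq0.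
Qed.

Lemma closed_field_uniq_seq (s : seq K) n : uniq s ->
  exists zs, [/\ uniq (s ++ zs) & size zs = n].
Proof.
move=> us; elim: n => [|n [zs [uz <-]]]; first by exists [::]; rewrite cats0.
have [x xs] := closed_field_fresh (s ++ zs); exists (rcons zs x); split.
  by rewrite -rcons_cat rcons_uniq xs.
by rewrite size_rcons.
Qed.

(* The derivative of [X^n + g1 X^(n-1) + g2 X^(n-2) + X + c] is nonzero and does
   not depend on [c], so a generic [c] makes the polynomial squarefree, in every
   characteristic. *)
Lemma squarefree_with_top_coefs (n : nat) (g1 g2 : K) : (4 <= n)%N ->
  exists zs : seq K, [/\ uniq zs, 0 \notin zs, size zs = n,
    (\prod_(z <- zs) ('X - z%:P))`_n.-1 = g1 &
    (\prod_(z <- zs) ('X - z%:P))`_n.-2 = g2].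
Proof.
case: n => [|[|[|[|n]]]] // _.
pose Q : {poly K} := 'X^(n.+4) + g1 *: 'X^(n.+3) + g2 *: 'X^(n.+2) + 'X.
have coefQ i : Q`_i = (i == n.+4)%:R + g1 * (i == n.+3)%:R + g2 * (i == n.+2)%:R
                      + (i == 1%N)%:R.
  by rewrite /Q !coefD !coefZ !coefXn coefX.
have dQ0 : Q^`() != 0.
  apply/eqP => /polyP/(_ 0%N)/eqP.
  by rewrite coef_deriv coefQ coef0 !mulr0 !add0r mulr1n oner_eq0.
have [r dQ] := closed_field_poly_normal Q^`().
(* Avoiding [0] keeps 0 from being a root of [H]; avoiding the [- Q.[z]] keeps the roots of the
   derivative from being roots of [H]. *)
have [c cr] := closed_field_fresh (0 :: [seq - Q.[z] | z <- r]).
move: cr; rewrite inE negb_or => /andP[nzc cr].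
pose H := Q + c%:P.
have coefH i : H`_i = Q`_i + c *+ (i == 0%N) by rewrite coefD coefC mulrb.
have coefHn j : (n.+4 <= j)%N -> H`_j = (j == n.+4)%:R.
  move=> jn; rewrite coefH coefQ.
  have [-> -> -> ->] : [/\ (j == n.+3) = false, (j == n.+2) = false,
    (j == 1%N) = false & (j == 0%N) = false] by split; lia.
  by rewrite !mulr0 mulr0n !addr0.
have szH : size H = n.+4.+1.
  apply/eqP; rewrite eqn_leq; apply/andP; split.
    apply/leq_sizeP => j jn; rewrite coefHn ?(ltnW jn) //.
    by rewrite (gtn_eqF jn).
  rewrite ltnNge; apply/negP => /leq_sizeP/(_ n.+4 (leqnn _))/eqP.
  by rewrite coefHn // eqxx oner_eq0.
have lcH : lead_coef H = 1 by rewrite /lead_coef szH coefHn // eqxx.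
have [zs Hzs] := closed_field_poly_normal H; rewrite lcH scale1r in Hzs.
have szzs : size zs = n.+4.
  by apply: succn_inj; rewrite -szH Hzs size_prod_XsubC.
have sepH : separable_poly H.
  rewrite separable_poly.unlock; apply/Pdiv.ClosedField.coprimepP => z Hz.
  rewrite /H derivD derivC addr0 dQ -rootE rootZ ?lead_coef_eq0 // root_prod_XsubC.
  apply: contra cr => zr; apply/mapP; exists z => //.
  by move: Hz; rewrite rootE !hornerE addrC addr_eq0 => /eqP.
exists zs; split=> //.
- by rewrite -separable_prod_XsubC -Hzs.
- rewrite -root_prod_XsubC -Hzs rootE horner_coef0 coefH coefQ /=.
  by rewrite !mulr0 !addr0 add0r.
- rewrite -Hzs coefH coefQ /= eqxx.
  have [-> ->] : (n.+3 == n.+4) = false /\ (n.+3 == n.+2) = false by lia.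
  by rewrite mulr1 mulr0 !addr0 add0r.
- rewrite -Hzs coefH coefQ /= eqxx.
  have [-> ->] : (n.+2 == n.+4) = false /\ (n.+2 == n.+3) = false by lia.
  by rewrite mulr1 mulr0 !addr0 !add0r.
Qed.

(* Sylvester's algorithm: the functional is annihilated by a squarefree form of
   degree [e.-1], written here in the reversed variable [1/X]. *)
Lemma jet_functional_eval (a b c : K) (e : nat) : c != 0 -> (5 <= e)%N ->
  exists (ts : seq K) (mu : K -> K), size ts = e.-1 /\
    forall f : {poly K}, (size f <= e.+1)%N ->
      a * f`_0 + b * f`_1 + c * f`_2 = \sum_(t <- ts) mu t * f.[t].
Proof.
move=> nzc; case: e => [|[|[|n]]] // le5.
(* For [H] monic of degree [n.+2] with next coefficients [g1] and [g2], these values make the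
   functional, read on the reversed polynomial, vanish at [H] and ['X * H]. *)
pose g1 := - b / c; pose g2 := - (a + b * g1) / c.
have [zs [uz z0 szz H1 H2]] := @squarefree_with_top_coefs n.+2 g1 g2 le5.
set H := \prod_(z <- zs) _ in H1 H2.
have szH : size H = n.+3 by rewrite size_prod_XsubC szz.
have monH : H \is monic by apply: monic_prod_XsubC.
have [lam lamP] := coef_interpolation n.+1 uz.
exists [seq z^-1 | z <- zs], (fun t => c * lam t^-1 * t^-1 ^+ n.+3).
split=> [|f szf]; first by rewrite size_map.
pose g : {poly K} := \poly_(i < n.+4) f`_(n.+3 - i).
have gE z : z != 0 -> g.[z] = z ^+ n.+3 * f.[z^-1].
  move=> nz; rewrite horner_poly (horner_coef_wide _ szf) mulr_sumr.
  rewrite (reindex_inj rev_ord_inj) /=; apply: eq_bigr => i _.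
  have ile : (i <= n.+3)%N by rewrite -ltnS.
  rewrite subSS subKn // mulrCA; congr (_ * _).
  by rewrite exprVn expfB_cond // (negbTE nz).
have -> : a * f`_0 + b * f`_1 + c * f`_2 = a * g`_n.+3 + b * g`_n.+2 + c * g`_n.+1.
  by rewrite !coef_poly !ltnS leqnn leqnSn !subnn !subSnn
    (leq_trans (leqnSn n) _) // subSS subSn // subSnn.
have coefDiv i : g`_i = ((g %/ H) * H)`_i + (g %% H)`_i.
  by rewrite {1}(divp_eq g H) coefD.
(* The quotient has degree at most 1, so [q * H] is killed; only the remainder counts, and the
   [n.+2] roots of [H] determine it. *)
set q := g %/ H in coefDiv; set r := g %% H in coefDiv.
have szr : (size r <= n.+2)%N by rewrite -ltnS -szH ltn_modp monic_neq0.
have szq : (size q <= 2)%N.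
  rewrite size_divp ?monic_neq0 // szH /= leq_subLR.
  by rewrite (leq_trans (size_poly _ _)) // addn2.
have qE : q = (q`_0)%:P + (q`_1) *: 'X.
  apply/polyP => i; rewrite coefD coefC coefZ coefX.
  case: i => [|[|i]]; rewrite ?mulr0 ?mulr1 ?addr0 ?add0r //=.
  by rewrite nth_default // (leq_trans szq).
have qH i : (q * H)`_i.+1 = q`_0 * H`_i.+1 + q`_1 * H`_i.
  by rewrite {1}qE mulrDl coefD coefCM -scalerAl coefZ coefXM.
have Hn2 : H`_n.+2 = 1 by move/monicP: monH; rewrite /lead_coef szH.
have Hn3 : H`_n.+3 = 0 by rewrite nth_default ?szH.
have -> : a * g`_n.+3 + b * g`_n.+2 + c * g`_n.+1 = c * r`_n.+1.
  rewrite !coefDiv !qH Hn2 Hn3 H1 (_ : H`_n = g2) //.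
  rewrite (nth_default _ (leq_trans szr (leqnSn _))) (nth_default _ szr).
  rewrite /g2 /g1; by field.
rewrite lamP ?szz // big_map mulr_sumr big_seq [RHS]big_seq.
apply: eq_bigr => z zz; rewrite invrK.
have nz : z != 0 by apply: contraNneq z0 => <-.
have -> : r.[z] = g.[z].
  rewrite (divp_eq g H) hornerD hornerM (_ : H.[z] = 0) ?mulr0 ?add0r //.
  by apply/rootP; rewrite root_prod_XsubC.
by rewrite gE //; ring.
Qed.

End Univariate.

(** * Rank bounds for normal forms *)

Definition lin (R : comNzRingType) (x y : R) : {poly R} := x%:P + y *: 'X.

Section Rank.
(* Each tensor factor, with repetitions, is a slot [s : S]; [tau s] is the
   factor it belongs to, and [pi] maps a coordinate to the factor carrying it.
   A point of the multiprojective space is a single function on [J]. *)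
Variables (I : eqType) (J S : finType) (pi : J -> I) (tau : S -> I).

Definition valid (M : S -> J) := forall s, pi (M s) = tau s.

Definition tens (R : comNzRingType) (v : J -> R) (M : S -> J) : R :=
  \prod_s v (M s).

Section OverK.
Variable K : closedFieldType.
Local Notation D := #|S|.

Definition rank_le (p : (S -> J) -> K) (b : nat) := exists r : seq (K * (J -> K)),
  (size r <= b)%N /\ forall M, valid M -> p M = \sum_(x <- r) x.1 * tens x.2 M.

Lemma rank_leW p b b' : (b <= b')%N -> rank_le p b -> rank_le p b'.
Proof. by move=> bb [r [sr rP]]; exists r; split=> //; apply: leq_trans bb. Qed.

Lemma rank_le_ext p q b : (forall M, valid M -> p M = q M) ->
  rank_le q b -> rank_le p b.
Proof. by move=> pq [r [sr rP]]; exists r; split=> // M vM; rewrite pq // rP. Qed.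

Lemma rank_leD p q b b' : rank_le p b -> rank_le q b' ->
  rank_le (fun M => p M + q M) (b + b').
Proof.
move=> [r [sr rP]] [r' [sr' rP']]; exists (r ++ r'); split.
  by rewrite size_cat leq_add.
by move=> M vM; rewrite big_cat /= rP // rP'.
Qed.

Lemma rank_le_tens c v : rank_le (fun M => c * tens v M) 1.
Proof. by exists [:: (c, v)]; split=> // M _; rewrite big_seq1. Qed.

Lemma rank_le_sum (I' : Type) (r : seq I') c v :
  rank_le (fun M => \sum_(i <- r) c i * tens (v i) M) (size r).
Proof.
exists [seq (c i, v i) | i <- r]; split; first by rewrite size_map.
by move=> M _; rewrite big_map.
Qed.

Lemma tens_horner (g : J -> {poly K}) M z :
  (tens g M).[z] = tens (fun j => (g j).[z]) M.
Proof. by rewrite /tens horner_prod. Qed.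

Lemma size_prod_le (A : finType) (P : pred A) (f : A -> {poly K}) e :
  (forall s, size (f s) <= e.+1)%N ->
  (size (\prod_(s | P s) f s)%R <= (e * #|P|).+1)%N.
Proof.
move=> sf; rewrite (leq_trans (size_prod_leq _ _)) // leq_subLR addnS ltnS.
have : (\sum_(s | P s) size (f s) <= \sum_(s | P s) e.+1)%N.
  by apply: leq_sum => s _; apply: sf.
by rewrite sum_nat_const mulnS [(#|P| * e)%N]mulnC.
Qed.

Lemma size_tens (g : J -> {poly K}) e M : (forall j, size (g j) <= e.+1)%N ->
  (size (tens g M) <= (e * D).+1)%N.
Proof. by move=> sg; apply: size_prod_le => s; apply: sg. Qed.

Definition line_pt (x y : J -> K) j : {poly K} := lin (x j) (y j).

Lemma size_line_pt x y j : (size (line_pt x y j) <= 2)%N.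
Proof.
rewrite (leq_trans (size_polyD _ _)) // geq_max (leq_trans (size_polyC_leq1 _)) //.
by rewrite (leq_trans (size_scale_leq _ _)) // size_polyX.
Qed.

Lemma horner_line_pt x y j z : (line_pt x y j).[z] = x j + y j * z.
Proof. by rewrite /line_pt /lin !hornerE. Qed.

(** Both terms come from coefficients 0 and 1 of one polynomial of degree at most [D], so the same
    [D.+1] nodes serve for both. *)
Lemma rank_tangent a x y :
  rank_le (fun M => a * tens x M + (tens (line_pt x y) M)`_1) D.+1.
Proof.
have [zs [uz szz]] := @closed_field_uniq_seq K [::] D.+1 isT.
have [l0 l0P] := coef_interpolation 0 uz.
have [l1 l1P] := coef_interpolation 1 uz.
rewrite -szz; apply: rank_le_ext (rank_le_sum zs
  (fun z => a * l0 z + l1 z) (fun z j => x j + y j * z)) => M vM.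
have szt : (size (tens (line_pt x y) M) <= size zs)%N.
  by rewrite szz -[D]mul1n; apply: size_tens => j; apply: size_line_pt.
have -> : tens x M = (tens (line_pt x y) M)`_0.
  rewrite -horner_coef0 tens_horner; apply: eq_bigr => s _.
  by rewrite horner_line_pt mulr0 addr0.
rewrite l0P // l1P // mulr_sumr -big_split; apply: eq_bigr => z _ /=.
rewrite tens_horner /tens; under eq_bigr do rewrite horner_line_pt.
by ring.
Qed.

Lemma rank_tangent_point a x y b z :
  rank_le (fun M => a * tens x M + (tens (line_pt x y) M)`_1 + b * tens z M) D.+2.
Proof. by have := rank_leD (rank_tangent a x y) (rank_le_tens b z); rewrite addn1. Qed.

Definition conic_pt (x y z : J -> K) j : {poly K} := line_pt x y j + z j *: 'X^2.

Lemma rank_conic a b c x y z : c != 0 -> (3 <= D)%N ->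
  rank_le (fun M => a * (tens (conic_pt x y z) M)`_0
    + b * (tens (conic_pt x y z) M)`_1 + c * (tens (conic_pt x y z) M)`_2)
    (2 * D - 1).
Proof.
move=> nzc D3; have D5 : (5 <= 2 * D)%N by lia.
have [ts [mu [szts muP]]] := jet_functional_eval a b nzc D5.
rewrite subn1 -szts.
apply: rank_le_ext (rank_le_sum ts mu (fun t j => (conic_pt x y z j).[t])) => M vM.
rewrite muP; first by apply: eq_bigr => t _; rewrite tens_horner.
apply: size_tens => j; rewrite (leq_trans (size_polyD _ _)) // geq_max.
rewrite (leq_trans (size_line_pt _ _ _)) //.
by rewrite (leq_trans (size_scale_leq _ _)) // size_polyXn.
Qed.

Lemma tens_isolated (R : comNzRingType) (v : J -> R) s0 M :
  tens v M = v (M s0) * \prod_(s | s != s0) v (M s).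
Proof. by rewrite /tens (bigD1 s0). Qed.

(** As [s0] is the only slot of its factor, any vector can be glued into that slot alone. The node 0
    is imposed on both interpolations: there the curves meet at [w], and these contributions merge
    with the term of [c] into one point. *)
Lemma rank_pencil s0 (c a b w x y : J -> K) :
  (forall s, tau s = tau s0 -> s = s0) ->
  rank_le (fun M => c (M s0) * \prod_(s | s != s0) w (M s)
     + a (M s0) * (\prod_(s | s != s0) line_pt w x (M s))`_1
     + b (M s0) * (\prod_(s | s != s0) line_pt w y (M s))`_1) (2 * D - 1).
Proof.
move=> iso; pose glue (u v : J -> K) j := if pi j == tau s0 then u j else v j.
have glueE u v M : valid M ->
    tens (glue u v) M = u (M s0) * \prod_(s | s != s0) v (M s).
  move=> vM; rewrite (tens_isolated _ s0) /glue vM eqxx; congr (_ * _).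
  apply: eq_bigr => s ss0; rewrite vM; case: eqP => // /iso sE.
  by rewrite sE eqxx in ss0.
have cardD : #|[pred s | s != s0]| = D.-1.
  by have := cardC1 s0; rewrite /predC1 /=.
have D0 : (0 < D)%N by apply/card_gt0P; exists s0.
have [zs [uz szz]] := @closed_field_uniq_seq K [:: 0] D.-1 isT.
have [l lP] := coef_interpolation 1 uz.
have lE u M : (\prod_(s | s != s0) line_pt w u (M s))`_1 =
    l 0 * \prod_(s | s != s0) w (M s) +
    \sum_(z <- zs) l z * \prod_(s | s != s0) (w (M s) + u (M s) * z).
  rewrite lP; last first.
    rewrite /= szz -cardD -[X in X.+1]mul1n.
    by apply: size_prod_le => s; apply: size_line_pt.
  rewrite big_cons; congr (_ * _ + _).
    rewrite horner_prod; apply: eq_bigr => s _.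
    by rewrite horner_line_pt mulr0 addr0.
  apply: eq_bigr => z _; congr (_ * _); rewrite horner_prod.
  by apply: eq_bigr => s _; rewrite horner_line_pt.
have -> : (2 * D - 1 = 1 + size zs + size zs)%N by rewrite szz; lia.
have R1 := rank_le_tens 1 (glue (fun j => c j + l 0 * a j + l 0 * b j) w).
have R2 (e u : J -> K) :=
  rank_le_sum zs l (fun z => glue e (fun j => w j + u j * z)).
apply: rank_le_ext (rank_leD (rank_leD R1 (R2 a x)) (R2 b y)) => M vM.
have sumE (e u : J -> K) : \sum_(z <- zs) l z * tens (glue e (fun j => w j + u j * z)) M
    = e (M s0) * \sum_(z <- zs) l z * \prod_(s | s != s0) (w (M s) + u (M s) * z).
  by rewrite mulr_sumr; apply: eq_bigr => z _; rewrite glueE // mulrCA.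
by rewrite !lE !sumE glueE //; ring.
Qed.

(** Interpolation would give [D.+2 = 4] points, one too many. If the slots lie in distinct factors,
    the sum regroups as [x] times [a x + y], plus [y] times [x], plus the last term; if they share a
    factor, it is a quadratic form. *)
Lemma rank_two_slots a x y c z : D = 2 ->
  rank_le (fun M => a * tens x M + (tens (line_pt x y) M)`_1 + c * tens z M) 3.
Proof.
move=> D2; have [s0 [s1 [ne01 allS]]] : exists s0 s1 : S, s0 != s1 /\
    forall R (idx : R) op f, \big[op/idx]_s f s = op (f s0) (op (f s1) idx).
  have : size (enum S) = 2 by rewrite -cardT.
  case E: (enum S) => [|s0 [|s1 []]] // _; exists s0, s1; split.
    by have := enum_uniq S; rewrite E /= inE andbT.
  by move=> R idx op f; rewrite [index_enum S]unlock -enumT E unlock.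
have tensE (R : comNzRingType) (v : J -> R) M : tens v M = v (M s0) * v (M s1).
  by rewrite /tens allS mulr1.
have lineE M : (tens (line_pt x y) M)`_1 =
    x (M s0) * y (M s1) + y (M s0) * x (M s1).
  have -> : tens (line_pt x y) M = (x (M s0) * x (M s1))%:P
    + (x (M s0) * y (M s1) + y (M s0) * x (M s1)) *: 'X
    + (y (M s0) * y (M s1)) *: 'X^2.
    by rewrite tensE /line_pt /lin -!mul_polyC !polyCD !polyCM; ring.
  by rewrite !coefD coefC !coefZ coefX coefXn /= mulr1 mulr0 addr0 add0r.
have [t01|ne] := eqVneq (tau s0) (tau s1); last first.
  pose glue (u v : J -> K) j := if pi j == tau s0 then u j else v j.
  have glueE u v M : valid M -> tens (glue u v) M = u (M s0) * v (M s1).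
    by move=> vM; rewrite tensE /glue !vM eqxx eq_sym (negbTE ne).
  have R1 := rank_le_tens 1 (glue x (fun j => a * x j + y j)).
  have R2 := rank_le_tens 1 (glue y x).
  apply: rank_le_ext (rank_leD (rank_leD R1 R2) (rank_le_tens c z)) => M vM.
  by rewrite lineE !glueE // tensE; ring.
have sqrt (d : K) : exists e, e ^+ 2 = d.
  have /closed_rootP[e] : size ('X^2 - d%:P : {poly K}) != 1%N.
    by rewrite size_XnsubC.
  by rewrite rootE !hornerE subr_eq0 => /eqP; exists e.
have [ra raE] := sqrt a; have [rc rcE] := sqrt c.
have [i iE] := sqrt (-1).
pose y' j := y j - ra * rc * z j; pose z' j := i * (ra * x j + rc * z j).
(* [a x^2 + c z^2] is a square up to a multiple of [x z], which is absorbed in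
   [y]; then the identity [x y - z^2 = (x + y + z)^2 - (x + z)^2 - (y + z)^2]
   needs no division by 2. *)
have R1 := rank_le_tens (-1) (fun j => z' j + x j).
have R2 := rank_le_tens (-1) (fun j => z' j + y' j).
have R3 := rank_le_tens 1 (fun j => z' j + x j + y' j).
apply: rank_le_ext (rank_leD (rank_leD R1 R2) R3) => M vM.
rewrite lineE !tensE /z' /y' -raE -rcE; ring: iE.
Qed.

End OverK.
End Rank.

(** * Specialization of products *)

Section Specialization.
Variables (F : fieldType) (K : closedFieldType) (O : F -> Prop) (res : F -> K).
Hypothesis pl : is_place O res.

Definition spec x a := O x /\ res x = a.

Lemma spec_res x : O x -> spec x (res x). Proof. by []. Qed.

Lemma spec_O x a : spec x a -> O x. Proof. by case. Qed.

Lemma spec_uniq x a b : spec x a -> spec x b -> a = b.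
Proof. by move=> [_ <-] [_ <-]. Qed.

Lemma spec1 : spec 1 1. Proof. by split; [exact: (place1 pl) | exact: (res1 pl)]. Qed.

Lemma specB x y a b : spec x a -> spec y b -> spec (x - y) (a - b).
Proof. by move=> [Ox <-] [Oy <-]; split; [exact: (placeB pl) | exact: (resB pl)]. Qed.

Lemma specM x y a b : spec x a -> spec y b -> spec (x * y) (a * b).
Proof. by move=> [Ox <-] [Oy <-]; split; [exact: (placeM pl) | exact: (resM pl)]. Qed.

Lemma spec0 : spec 0 0.
Proof. by have := specB spec1 spec1; rewrite !subrr. Qed.

Lemma specN x a : spec x a -> spec (- x) (- a).
Proof. by move/(specB spec0); rewrite !sub0r. Qed.

Lemma specD x y a b : spec x a -> spec y b -> spec (x + y) (a + b).
Proof. by move=> Sx /specN /(specB Sx); rewrite !opprK. Qed.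

Lemma spec_eq x y a b : spec x a -> x = y -> a = b -> spec y b.
Proof. by move=> Sx <- <-. Qed.

Lemma spec_val x a b : spec x a -> a = b -> spec x b.
Proof. by move=> Sx <-. Qed.

Lemma spec_notO x : ~ O x -> spec x^-1 0.
Proof. exact: (placeV pl). Qed.

Lemma specV x a : spec x a -> a != 0 -> spec x^-1 a^-1.
Proof.
move=> Sx nza; have nzx : x != 0.
  by apply: contraNneq nza => x0;
    rewrite (spec_uniq Sx (a := a) (b := 0)) // x0; exact: spec0.
have [/spec_res SV|nO] := pselect (O x^-1); last first.
  have := spec_notO nO; rewrite invrK => /(spec_uniq Sx) a0.
  by rewrite a0 eqxx in nza.
apply: (spec_eq SV) => //; apply: (mulfI nza); rewrite divff //.
by apply: spec_uniq (specM Sx SV) _; rewrite divff //; exact: spec1.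
Qed.

Lemma spec_divides x y : (exists2 t, O t & x = t * y) \/ exists2 t, O t & y = t * x.
Proof.
have [->|nzx] := eqVneq x 0.
  by left; exists 0; [exact: spec_O spec0 | rewrite mul0r].
have [Oxy|nO] := pselect (O (y / x)).
  by right; exists (y / x); rewrite ?divfK.
have [Oyx _] := spec_notO nO; left; exists (x / y); first by rewrite invf_div in Oyx.
have [y0|nzy] := eqVneq y 0; last by rewrite divfK.
by case: nO; rewrite y0 mul0r; exact: spec_O spec0.
Qed.

(** Divisibility over [O] is a total preorder, so a finite family has a member dividing all the
    others. Dividing by it is how vectors are made integral with a coordinate 1. *)
Lemma spec_max (A : finType) (P : pred A) (f : A -> F) a0 : P a0 ->
  exists2 a, P a & forall x, P x -> exists2 t, O t & f x = t * f a.
Proof.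
move=> Pa0; suff H (r : seq A) : exists2 a, P a &
    forall x, x \in r -> P x -> exists2 t, O t & f x = t * f a.
  by have [a Pa aP] := H (enum A); exists a => // x; apply: aP; rewrite mem_enum.
elim: r => [|y r [a Pa aP]]; first by exists a0.
have [Py|nPy] := boolP (P y); last first.
  exists a => // x; rewrite inE => /orP[/eqP ->|]; last exact: aP.
  by move=> Py; rewrite Py in nPy.
have [[t Ot ty]|[t Ot ty]] := spec_divides (f y) (f a).
  exists a => // x; rewrite inE => /orP[/eqP -> _|]; last exact: aP.
  by exists t.
exists y => // x; rewrite inE => /orP[/eqP -> _|xr Px].
  by exists 1; [exact: spec_O spec1 | rewrite mul1r].
have [t' Ot' t'x] := aP x xr Px; exists (t' * t); first exact: (placeM pl).
by rewrite t'x ty mulrA.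
Qed.

End Specialization.

Ltac sp := repeat first
  [eassumption | apply: specD | apply: specM | apply: specN
  | (apply: spec1) | (apply: spec0)].
Ltac spec_ring := apply: spec_val; [sp | try ring].

Section SpecProducts.
Variables (F : fieldType) (K : closedFieldType) (O : F -> Prop) (res : F -> K).
Hypothesis pl : is_place O res.
Local Notation spec := (spec O res).

Lemma coef_mul_lin (R : comNzRingType) (x y : R) (f : {poly R}) :
  [/\ (lin x y * f)`_0 = x * f`_0, (lin x y * f)`_1 = x * f`_1 + y * f`_0
    & (lin x y * f)`_2 = x * f`_2 + y * f`_1].
Proof.
have E i : (lin x y * f)`_i = x * f`_i + y * (f * 'X)`_i.
  by rewrite /lin mulrDl coefD coefCM -scalerAl coefZ mulrC [f * 'X]mulrC.
by rewrite !E !coefMX /= mulr0 addr0.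
Qed.

Section Products.
Variables (T : Type) (r : seq T) (P : pred T).

(** The linear coefficient is the derivative of the product in the direction of the second
    arguments, hence linear in that direction. *)
Lemma coef1_prod_linear (R : comNzRingType) (x y z : T -> R) (a b : R) :
  (\prod_(s <- r | P s) lin (x s) (a * y s + b * z s))`_1 =
  a * (\prod_(s <- r | P s) lin (x s) (y s))`_1 +
  b * (\prod_(s <- r | P s) lin (x s) (z s))`_1.
Proof.
suff [] : [/\ (\prod_(s <- r | P s) lin (x s) (a * y s + b * z s))`_1 =
  a * (\prod_(s <- r | P s) lin (x s) (y s))`_1 +
  b * (\prod_(s <- r | P s) lin (x s) (z s))`_1,
  (\prod_(s <- r | P s) lin (x s) (y s))`_0 =
  (\prod_(s <- r | P s) lin (x s) (z s))`_0 &
  (\prod_(s <- r | P s) lin (x s) (a * y s + b * z s))`_0 =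
  (\prod_(s <- r | P s) lin (x s) (z s))`_0] by [].
elim: r => [|s t IH]; first by rewrite !big_nil !coefC /= !mulr0 addr0.
rewrite !big_cons; case: ifP => // _.
set f := \prod_(i <- t | _) _ in IH *; set g := \prod_(i <- t | _) _ in IH *.
set h := \prod_(i <- t | _) _ in IH *; case: IH => I1 I2 I3.
have [E1 E2 _] := coef_mul_lin (x s) (a * y s + b * z s) f.
have [G1 G2 _] := coef_mul_lin (x s) (y s) g.
have [H1 H2 _] := coef_mul_lin (x s) (z s) h.
by rewrite E1 E2 G1 G2 H1 H2 I1 I2 I3; split=> //; ring.
Qed.

Lemma coef_top_prod_lin (R : comNzRingType) (x y : T -> R) :
  (\prod_(s <- r) lin (x s) (y s))`_(size r) = \prod_(s <- r) y s.
Proof.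
suff [] : (\prod_(s <- r) lin (x s) (y s))`_(size r) = \prod_(s <- r) y s /\
  forall i, (size r < i)%N -> (\prod_(s <- r) lin (x s) (y s))`_i = 0 by [].
elim: r => [|s t [IH1 IH2]].
  by rewrite !big_nil coefC; split=> // -[|i] //; rewrite coefC.
have E i : (lin (x s) (y s) * \prod_(j <- t) lin (x j) (y j))`_i.+1 =
    x s * (\prod_(j <- t) lin (x j) (y j))`_i.+1 +
    y s * (\prod_(j <- t) lin (x j) (y j))`_i.
  by rewrite /lin mulrDl coefD coefCM -scalerAl coefZ coefXM.
rewrite !big_cons /= E IH1 IH2 // mulr0 add0r; split=> // -[|i] // lti.
by rewrite E !IH2 ?mulr0 ?addr0 // ltnW.
Qed.

(** A direction added in order two enters the coefficient of ['X^2] only through the derivative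
    along it. This absorbs a leftover tangent term into a conic. *)
Lemma coef_prod_conic (R : comNzRingType) (x y z : T -> R) (c : R) :
  let A := \prod_(s <- r | P s) lin (x s) (y s) in
  let B := \prod_(s <- r | P s) lin (x s) (z s) in
  let C := \prod_(s <- r | P s) (lin (x s) (y s) + (c * z s) *: 'X^2) in
  [/\ C`_0 = A`_0, C`_1 = A`_1 & C`_2 = A`_2 + c * B`_1] /\ B`_0 = A`_0.
Proof.
elim: r => [|s t [[I0 I1 I2] I3]] /=.
  by rewrite !big_nil !coefC /= mulr0 addr0.
rewrite !big_cons; case: ifP => // _.
set A := \prod_(i <- t | _) _ in I0 I1 I2 I3 *.
set C := \prod_(i <- t | _) (_ + _) in I0 I1 I2 I3 *.
set B := \prod_(i <- t | _) _ in I0 I1 I2 I3 *.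
have [A0 A1 A2] := coef_mul_lin (x s) (y s) A.
have [B0 B1 B2] := coef_mul_lin (x s) (z s) B.
have [C0 C1 C2] := coef_mul_lin (x s) (y s) C.
rewrite mulrDl -!scalerAl !coefD !coefZ !coefXnM /= A0 A1 A2 B0 B1 C0 C1 C2.
by rewrite I0 I1 I2 I3 ?subnn !mulr0 !addr0; split=> //; split=> //; ring.
Qed.

Lemma spec_prod (w : T -> F) (W : T -> K) : (forall s, P s -> spec (w s) (W s)) ->
  spec (\prod_(s <- r | P s) w s) (\prod_(s <- r | P s) W s).
Proof.
by move=> wW; apply: big_ind2 => [|? ? ? ?|];
  [exact: (spec1 pl) | exact: (specM pl) | exact: wW].
Qed.

(** First-order Taylor expansion: the increments [y s] specialize to 0 while [c * y s] stays finite,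
    so [c] times a product of two increments specializes to 0. *)
Lemma spec_taylor1 (c : F) (w y : T -> F) (W B : T -> K) :
  (forall s, P s -> [/\ spec (w s) (W s), spec (y s) 0 & spec (c * y s) (B s)]) ->
  spec (c * (\prod_(s <- r | P s) (w s + y s) - \prod_(s <- r | P s) w s))
       (\prod_(s <- r | P s) lin (W s) (B s))`_1.
Proof.
move=> H.
suff [d [-> _ Scd _ _]] : exists d,
  [/\ \prod_(s <- r | P s) (w s + y s) = \prod_(s <- r | P s) w s + d,
      spec d 0, spec (c * d) (\prod_(s <- r | P s) lin (W s) (B s))`_1,
      spec (\prod_(s <- r | P s) w s) (\prod_(s <- r | P s) W s) &
      (\prod_(s <- r | P s) lin (W s) (B s))`_0 = \prod_(s <- r | P s) W s].
  by rewrite addrC addKr.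
elim: r => [|s t [d [E Sd Scd Sf f0]]].
  exists 0; rewrite !big_nil addr0 mulr0 !coefC /=.
  by split=> //; [exact: (spec0 pl) | exact: (spec0 pl) | exact: (spec1 pl)].
rewrite !big_cons; case: ifP => [/H[Sw Sy Scy]|_]; last by exists d.
have [C0 C1 _] := coef_mul_lin (W s) (B s) (\prod_(s <- t | P s) lin (W s) (B s)).
rewrite E C0 C1 f0.
exists (w s * d + y s * \prod_(s <- t | P s) w s + y s * d); split=> //.
- by ring.
- by spec_ring.
- apply: (spec_eq (specD pl (specD pl (specM pl Sw Scd) (specM pl Scy Sf))
    (specM pl Scy Sd))); by ring.
- exact: (specM pl).
Qed.

(* [x, y, z, w] are divided differences of a function taking the values [f1],
   [f2], [f3] at the points [0], [d u], [e u + rho r]. *)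
Variables (d e rho : F).
Hypotheses (Sd : spec d 0) (Se : spec e 0) (Srho : spec rho 0).

Definition jet (f1 f2 f3 x y z w : F) :=
  [/\ f1 = x, f2 = x + d * y & f3 = x + e * y + e * (e - d) * z + rho * w].

Lemma jet_sum c1 c2 c3 f1 f2 f3 x y z w : jet f1 f2 f3 x y z w ->
  c1 * f1 + c2 * f2 + c3 * f3 =
  (c1 + c2 + c3) * x + (c2 * d + c3 * e) * y + (c3 * (e * (e - d))) * z
    + (c3 * rho) * w.
Proof. by move=> [-> -> ->]; ring. Qed.

(** Leibniz rule for divided differences. The formulas contain no division, so coincident points
    need no separate treatment. *)
Lemma jetM f1 f2 f3 x y z w g1 g2 g3 x' y' z' w' :
  jet f1 f2 f3 x y z w -> jet g1 g2 g3 x' y' z' w' ->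
  jet (f1 * g1) (f2 * g2) (f3 * g3) (x * x') (x * y' + y * x' + d * y * y')
    (x * z' + z * x' + y * y' + e * (y * z' + z * y') + e * (e - d) * (z * z'))
    (x * w' + w * x' + e * (y * w' + w * y') + e * (e - d) * (z * w' + w * z')
      + rho * (w * w')).
Proof. by move=> [-> -> ->] [-> -> ->]; split; ring. Qed.

Variables (v u r' : T -> F) (V U R' : T -> K).
Let f1 s := v s.
Let f2 s := v s + d * u s.
Let f3 s := v s + e * u s + rho * r' s.

Let jet_factor s : jet (f1 s) (f2 s) (f3 s) (v s) (u s) 0 (r' s).
Proof. by split; rewrite /f1 /f2 /f3 //; ring. Qed.

Let jet_one : jet 1 1 1 1 0 0 0.
Proof. by split; ring. Qed.

(** Divided differences at points that merge specialize to Taylor coefficients: the corrections in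
    the Leibniz rule all carry a factor [d], [e] or [rho]. *)
Lemma jet_prod :
  (forall s, P s -> [/\ spec (v s) (V s), spec (u s) (U s) & spec (r' s) (R' s)]) ->
  exists x y z w,
    [/\ jet (\prod_(s <- r | P s) f1 s) (\prod_(s <- r | P s) f2 s)
            (\prod_(s <- r | P s) f3 s) x y z w,
        spec x (\prod_(s <- r | P s) lin (V s) (U s))`_0,
        spec y (\prod_(s <- r | P s) lin (V s) (U s))`_1,
        spec z (\prod_(s <- r | P s) lin (V s) (U s))`_2 &
        spec w (\prod_(s <- r | P s) lin (V s) (R' s))`_1].
Proof.
move=> H.
suff : exists x y z w,
    [/\ jet (\prod_(s <- r | P s) f1 s) (\prod_(s <- r | P s) f2 s)
            (\prod_(s <- r | P s) f3 s) x y z w,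
        spec x (\prod_(s <- r | P s) lin (V s) (U s))`_0,
        spec y (\prod_(s <- r | P s) lin (V s) (U s))`_1,
        spec z (\prod_(s <- r | P s) lin (V s) (U s))`_2 &
        spec w (\prod_(s <- r | P s) lin (V s) (R' s))`_1] /\
    (\prod_(s <- r | P s) lin (V s) (R' s))`_0 =
    (\prod_(s <- r | P s) lin (V s) (U s))`_0.
  by move=> [x [y [z [w [? _]]]]]; exists x, y, z, w.
elim: r => [|s t [x [y [z [w [[J Sx Sy Sz Sw] AB0]]]]]].
  rewrite !big_nil !coefC /=; exists 1, 0, 0, 0; split=> //; split=> //.
  - exact: (spec1 pl).
  - exact: (spec0 pl).
  - exact: (spec0 pl).
  - exact: (spec0 pl).
rewrite !big_cons; case: ifP => [/H[Sv Su Sr]|_]; last by exists x, y, z, w.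
have {}J := jetM (jet_factor s) J.
do 4!eexists; split; first split; first exact: J.
all: have [A0 A1 A2] := coef_mul_lin (V s) (U s) (\prod_(s <- t | P s) lin (V s) (U s)).
all: have [B0 B1 _] := coef_mul_lin (V s) (R' s) (\prod_(s <- t | P s) lin (V s) (R' s)).
all: rewrite ?A0 ?A1 ?A2 ?B0 ?B1 ?AB0 //; rewrite ?AB0 in Sw *.
- exact: (specM pl).
- by spec_ring.
- have S0 := spec0 pl; by spec_ring.
- have S0 := spec0 pl; by spec_ring.
Qed.

(* Here [u] specializes to [0], but so slowly that [h * u] stays finite. *)
Lemma jet_prod_slow (h : F) (B : T -> K) :
  (forall s, P s -> [/\ spec (v s) (V s), spec (u s) 0, spec (r' s) (R' s)
                      & spec (h * u s) (B s)]) ->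
  exists x y z w,
    [/\ jet (\prod_(s <- r | P s) f1 s) (\prod_(s <- r | P s) f2 s)
            (\prod_(s <- r | P s) f3 s) x y z w,
        spec x (\prod_(s <- r | P s) V s),
        spec y 0 /\ spec (h * y) (\prod_(s <- r | P s) lin (V s) (B s))`_1,
        spec z 0 /\ spec (h * z) 0 &
        spec w (\prod_(s <- r | P s) lin (V s) (R' s))`_1].
Proof.
move=> H.
suff : exists x y z w,
    [/\ jet (\prod_(s <- r | P s) f1 s) (\prod_(s <- r | P s) f2 s)
            (\prod_(s <- r | P s) f3 s) x y z w,
        spec x (\prod_(s <- r | P s) V s),
        spec y 0 /\ spec (h * y) (\prod_(s <- r | P s) lin (V s) (B s))`_1,
        spec z 0 /\ spec (h * z) 0 &
        spec w (\prod_(s <- r | P s) lin (V s) (R' s))`_1] /\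
    (\prod_(s <- r | P s) lin (V s) (R' s))`_0 = \prod_(s <- r | P s) V s /\
    (\prod_(s <- r | P s) lin (V s) (B s))`_0 = \prod_(s <- r | P s) V s.
  by move=> [x [y [z [w [? _]]]]]; exists x, y, z, w.
elim: r => [|s t [x [y [z [w [[J Sx [Sy Shy] [Sz Shz] Sw] [AB0 AC0]]]]]]].
  rewrite !big_nil !coefC /=; exists 1, 0, 0, 0; rewrite mulr0.
  by have S0 := spec0 pl; split=> //; split=> //; exact: (spec1 pl).
rewrite !big_cons; case: ifP => [/H[Sv Su Sr Shu]|_]; last by exists x, y, z, w.
have {}J := jetM (jet_factor s) J.
have [C0 C1 _] := coef_mul_lin (V s) (B s) (\prod_(s <- t | P s) lin (V s) (B s)).
have [B0 B1 _] := coef_mul_lin (V s) (R' s) (\prod_(s <- t | P s) lin (V s) (R' s)).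
rewrite B0 B1 C0 C1 AB0 AC0.
have S0 := spec0 pl.
do 4!eexists; split; last by [].
split; first exact: J.
- exact: (specM pl).
- split; first by spec_ring.
  apply: (spec_eq (specD pl (specD pl (specM pl Sv Shy) (specM pl Shu Sx))
    (specM pl Sd (specM pl Shu Sy)))); by ring.
- split; first by spec_ring.
  apply: (spec_eq (specD pl (specD pl (specM pl Sv Shz) (specM pl Shu Sy))
    (specM pl Se (specM pl Shu Sz)))); by ring.
- by spec_ring.
Qed.

End Products.
End SpecProducts.

(** * Limits of three points *)

Section Limits.
Variables (F : fieldType) (K : closedFieldType) (O : F -> Prop) (res : F -> K).
Hypothesis pl : is_place O res.
Local Notation spec := (spec O res).
Variables (I : eqType) (J S : finType) (pi : J -> I) (tau : S -> I).
Hypothesis tau_surj : forall i, exists s, tau s = i.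
Local Notation valid := (valid pi tau).
Local Notation D := #|S|.

Definition limit_of c1 v1 c2 v2 c3 v3 (p : (S -> J) -> K) := forall M, valid M ->
  spec (c1 * tens v1 M + c2 * tens v2 M + c3 * tens v3 M) (p M).

Lemma limit_swap12 c1 v1 c2 v2 c3 v3 p :
  limit_of c1 v1 c2 v2 c3 v3 p -> limit_of c2 v2 c1 v1 c3 v3 p.
Proof. by move=> L M /L; rewrite [c2 * _ + _]addrC. Qed.

Lemma limit_swap23 c1 v1 c2 v2 c3 v3 p :
  limit_of c1 v1 c2 v2 c3 v3 p -> limit_of c1 v1 c3 v3 c2 v2 p.
Proof. by move=> L M /L; rewrite addrAC. Qed.

Definition integral (v : J -> F) := forall j, O (v j).
(** Together with integrality, this makes the reduction nonzero in every factor, hence a point of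
    the product of projective spaces. *)
Definition based (v : J -> F) (b : I -> J) := forall i, pi (b i) = i /\ v (b i) = 1.
Definition primitive v := integral v /\ exists b, based v b.

(* The [i]-th components of the specializations of [v] and [w] are distinct
   points of projective space. *)
Definition separated i (v w : J -> F) := exists j j', [/\ pi j = i, pi j' = i &
  res (v j * w j' - v j' * w j) != 0].

Lemma separatedC i v w : separated i v w -> separated i w v.
Proof.
move=> [j [j' [pj pj' nz]]]; exists j', j; split=> //.
by move: nz; congr (res _ != 0); ring.
Qed.

Lemma spec_fresh v : integral v -> forall j, spec (v j) (res (v j)).
Proof. by move=> Ov j; apply: spec_res. Qed.

Definition set_slot (M : S -> J) s j := fun t => if t == s then j else M t.

Lemma valid_set_slot M s j : valid M -> pi j = tau s -> valid (set_slot M s j).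
Proof. by move=> vM pj t; rewrite /set_slot; case: eqP => [->|]. Qed.

Lemma tens_set_slot (R : comNzRingType) (v : J -> R) M s j :
  tens v (set_slot M s j) = v j * \prod_(t | t != s) v (M t).
Proof.
rewrite (tens_isolated _ s) /set_slot eqxx; congr (_ * _).
by apply: eq_bigr => t /negbTE ->.
Qed.

Lemma tens_set_slot2 (R : comNzRingType) (v : J -> R) M s s' j j' : s != s' ->
  tens v (set_slot (set_slot M s' j') s j) =
  v j * v j' * \prod_(t | (t != s) && (t != s')) v (M t).
Proof.
move=> ne; rewrite tens_set_slot (bigD1 s') ?(eq_sym s') //= mulrA.
rewrite {1}/set_slot eqxx; congr (_ * _).
by apply: eq_bigr => t /andP[_ /negbTE ts']; rewrite /set_slot ts'.
Qed.

(** The origin of an affine chart: a based vector has tensor 1 here, and changing one or two slots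
    reads off [v j] or [v j * v j']. These are the test coordinates that show coefficients to be
    integral. *)
Definition base_idx (b : I -> J) : S -> J := fun s => b (tau s).

Lemma base_valid v b : based v b -> valid (base_idx b).
Proof. by move=> vb s; case: (vb (tau s)). Qed.

Lemma tens_base v b : based v b -> tens v (base_idx b) = 1.
Proof. by move=> vb; apply: big1 => s _; case: (vb (tau s)). Qed.

Lemma tens_base1 v b s j : based v b -> tens v (set_slot (base_idx b) s j) = v j.
Proof.
move=> vb; rewrite tens_set_slot big1 ?mulr1 // => t _.
by case: (vb (tau t)).
Qed.

Lemma tens_base2 v b s s' j j' : based v b -> s != s' ->
  tens v (set_slot (set_slot (base_idx b) s' j') s j) = v j * v j'.
Proof.
move=> vb ne; rewrite tens_set_slot2 // big1 ?mulr1 // => t _.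
by case: (vb (tau t)).
Qed.

Lemma normalize c v (pi_surj : forall i, exists j, pi j = i) :
  exists c' v', primitive v' /\ forall M, valid M -> c * tens v M = c' * tens v' M.
Proof.
have [[s zs]|nz] := pselect (exists s, forall j, pi j = tau s -> v j = 0).
  have [b bP] := choice pi_surj.
  (* A vector vanishing on a whole factor has zero tensor, so any primitive vector serves with
     coefficient 0. *)
  exists 0, (fun=> 1); split.
    split; first by move=> j; exact: spec_O (spec1 pl).
    by exists b.
  by move=> M vM; rewrite (tens_isolated _ s) zs ?mul0r ?mulr0 // vM.
have /choice[b bP] i : exists b, [/\ pi b = i, v b != 0 &
    forall j, pi j = i -> exists2 t, O t & v j = t * v b].
  have [s si] := tau_surj i.
  have [j0 [pj0 nzj0]] : exists j, pi j = i /\ v j <> 0.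
    apply: contrapT => no; apply: nz; exists s => j; rewrite si => pj.
    by apply: contrapT => nzj; apply: no; exists j.
  have [|b /eqP pb bmax] := @spec_max _ _ _ _ pl J (fun j => pi j == i) v j0.
    by rewrite pj0.
  exists b; split=> //; last by move=> j /eqP; apply: bmax.
  apply/eqP => vb; have [t _] := bmax j0 (introT eqP pj0).
  by rewrite vb mulr0.
exists (c * \prod_s v (b (tau s))), (fun j => v j / v (b (pi j))); split.
  split=> [j|].
    have [_ nzb /(_ j erefl)[t Ot ->]] := bP (pi j).
    by rewrite mulfK.
  by exists b => i; have [pb nzb _] := bP i; rewrite pb divff.
move=> M vM; rewrite -mulrA; congr (_ * _).
rewrite /tens -big_split; apply: eq_bigr => s _ /=.
by have [_ nzb _] := bP (tau s); rewrite vM mulrCA divff // mulr1.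
Qed.

(* Off the factors where they are separated, two points have a common
   normalization. *)
Lemma rebase (A : pred I) v b w : integral v -> based v b -> primitive w ->
  (forall i, A i -> ~ separated i v w) ->
  exists w' l, [/\ forall M, valid M -> tens w M = l * tens w' M,
    integral w', forall i, A i -> w' (b i) = 1,
    forall j, A (pi j) -> spec (w' j - v j) 0 &
    forall j, ~~ A (pi j) -> w' j = w j].
Proof.
move=> Ov vb [Ow [bw wb]] ns.
(* If [w (b i)] reduced to 0, the minor of [v] and [w] at [b i] and [bw i] would reduce to 1 and
   separate them. *)
have unit i : A i -> res (w (b i)) != 0.
  move=> Ai; apply/eqP => r0; apply: (ns i Ai); exists (b i), (bw i).
  have [p1 v1] := vb i; have [p2 w1] := wb i; split=> //.
  have -> : res (v (b i) * w (bw i) - v (bw i) * w (b i)) = 1.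
    have := specB pl (specM pl (spec_fresh Ov (b i)) (spec_fresh Ow (bw i)))
      (specM pl (spec_fresh Ov (bw i)) (spec_fresh Ow (b i))).
    case=> _ ->; rewrite r0 v1 w1; case: (spec1 pl) => _ ->.
    by rewrite mulr1 mulr0 subr0.
  exact: oner_neq0.
pose l i := if A i then w (b i) else 1.
have ul i : res (l i) != 0 /\ O (l i).
  rewrite /l; case: ifP => [Ai|_]; first by split; [exact: unit | exact: Ow].
  by case: (spec1 pl) => O1 ->; split=> //; exact: oner_neq0.
have nzl i : l i != 0.
  apply: contraNneq (ul i).1 => ->; by case: (spec0 pl) => _ ->.
have Sl i : spec (l i)^-1 (res (l i))^-1.
  by have [ri Oi] := ul i; apply: specV.
exists (fun j => w j / l (pi j)), (\prod_s l (tau s)); split.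
- move=> M vM; rewrite /tens -big_split; apply: eq_bigr => s _ /=.
  by rewrite vM mulrCA divff // mulr1.
- by move=> j; apply: (placeM pl) => //; case: (Sl (pi j)).
- move=> i Ai; have [pb _] := vb i.
  by have := nzl i; rewrite pb /l Ai => /divff.
- move=> j Aj; have [pb vb1] := vb (pi j).
  have S0 : spec (w j * v (b (pi j)) - v j * w (b (pi j))) 0.
    have OO : O (v (b (pi j)) * w j - v j * w (b (pi j))).
      by apply: (placeB pl); apply: (placeM pl).
    apply: spec_eq (spec_res res OO) _ _; first by rewrite [w j * _]mulrC.
    apply: contrapT => /eqP nz; apply: (ns _ Aj).
    by exists (b (pi j)), j.
  apply: spec_eq (specM pl S0 (Sl (pi j))) _ _; last by rewrite mul0r.
  have := nzl (pi j); rewrite /l Aj => nz.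
  by rewrite vb1 mulr1 mulrBl mulfK.
- by move=> j /negbTE nA; rewrite /l nA divr1.
Qed.

(* A product of forms on two distinct slots that vanishes at [v2] and [v3] but
   not at the specialization of [v1]. *)
Lemma coef_integral c1 v1 c2 v2 c3 v3 p s s' :
  limit_of c1 v1 c2 v2 c3 v3 p -> primitive v1 -> integral v2 -> integral v3 ->
  s != s' -> separated (tau s) v1 v2 -> separated (tau s') v1 v3 -> O c1.
Proof.
move=> L [O1 [b vb]] O2 O3 ne [j [j' [pj pj' nz]]] [k [k' [pk pk' nz']]].
pose Mjk x y := set_slot (set_slot (base_idx b) s' y) s x.
have vMjk x y : pi x = tau s -> pi y = tau s' -> valid (Mjk x y).
  by move=> px py; do 2!apply: valid_set_slot => //; exact: base_valid vb.
have Lq x y : pi x = tau s -> pi y = tau s' -> O (c1 * tens v1 (Mjk x y)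
    + c2 * tens v2 (Mjk x y) + c3 * tens v3 (Mjk x y)).
  by move=> px py; case: (L _ (vMjk x y px py)).
set lam := _ - _ in nz; set lam' := _ - _ in nz'.
have Olam : O lam by apply: (placeB pl); apply: (placeM pl).
have Olam' : O lam' by apply: (placeB pl); apply: (placeM pl).
have Sll : spec (lam * lam') (res lam * res lam') by apply: specM.
have nzr : res lam * res lam' != 0 by apply: mulf_neq0.
have nzl : lam * lam' != 0.
  apply: contraNneq nzr => l0; rewrite (spec_uniq Sll (b := 0)) // l0.
  exact: spec0.
have [OV _] := specV pl Sll nzr.
suff : O (c1 * (lam * lam')) by move/(placeM pl)/(_ OV); rewrite mulfK.
have E (v : J -> F) x y : tens v (Mjk x y) =
    v x * v y * \prod_(t | (t != s) && (t != s')) v (base_idx b t).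
  exact: tens_set_slot2.
have E1 x y : tens v1 (Mjk x y) = v1 x * v1 y by apply: tens_base2.
pose q x y := c1 * tens v1 (Mjk x y) + c2 * tens v2 (Mjk x y) + c3 * tens v3 (Mjk x y).
(* Contraction with a linear form in each of the slots [s] and [s'], the first killing [v2] and the
   second [v3]. *)
have -> : c1 * (lam * lam') = v2 j' * v3 k' * q j k - v2 j' * v3 k * q j k'
    - v2 j * v3 k' * q j' k + v2 j * v3 k * q j' k'.
  rewrite /q !E1 !(E v2) !(E v3) /lam /lam'; ring.
have Oq x y : pi x = tau s -> pi y = tau s' -> O (q x y) by exact: Lq.
have OD x y : O x -> O y -> O (x + y).
  by move=> Ox Oy; case: (specD pl (spec_res res Ox) (spec_res res Oy)).
by apply: OD; [apply: (placeB pl); [apply: (placeB pl)|]|];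
  do ?apply: (placeM pl) => //; apply: Oq.
Qed.

(** * Normal forms according to which reductions coincide *)

Variable p : (S -> J) -> K.
Hypothesis D2 : (2 <= D)%N.

Lemma rank_of_integral_coefs c1 v1 c2 v2 c3 v3 :
  limit_of c1 v1 c2 v2 c3 v3 p -> integral v1 -> integral v2 -> integral v3 ->
  O c1 -> O c2 -> O c3 -> rank_le pi tau p (2 * D - 1).
Proof.
move=> L O1 O2 O3 Oc1 Oc2 Oc3; apply: (@rank_leW _ _ _ _ _ _ _ 3); first by lia.
have R c v := rank_le_tens pi tau (res c) (res \o v).
apply: rank_le_ext (rank_leD (rank_leD (R c1 v1) (R c2 v2)) (R c3 v3)) => M vM.
apply: (spec_uniq (L M vM)).
have T v : integral v -> spec (tens v M) (tens (res \o v) M).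
  by move=> Ov; apply: spec_prod => // s _; apply: spec_fresh.
by do !apply: specD => //; apply: specM => //; apply: T.
Qed.

(** Outside the factor of [s0] the three points have the reduction of [v3]. A first-order expansion
    there around [v3] leaves the vectors [A], [v1], [v2] in the slot [s0] and the directions
    [c1 (v1 - v3)] and [c2 (v2 - v3)], whose integrality is the point to prove. *)
Lemma rank_of_pencil c1 v1 c2 v2 c3 v3 s0 b :
  limit_of c1 v1 c2 v2 c3 v3 p ->
  integral v1 -> integral v2 -> integral v3 ->
  (forall s, tau s = tau s0 -> s = s0) -> separated (tau s0) v1 v2 ->
  (forall i, pi (b i) = i) ->
  (forall i, i != tau s0 -> [/\ v1 (b i) = 1, v2 (b i) = 1 & v3 (b i) = 1]) ->
  (forall j, pi j != tau s0 -> spec (v1 j - v3 j) 0 /\ spec (v2 j - v3 j) 0) ->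
  rank_le pi tau p (2 * D - 1).
Proof.
move=> L O1 O2 O3 iso [j1 [j2 [pj1 pj2 nz]]] pb b1 m.
have iso' s : s != s0 -> tau s != tau s0.
  by move=> ne; apply: contra ne => /eqP /iso ->.
have vb : valid (base_idx b) by move=> s; rewrite pb.
have W1 (v : J -> F) (P : pred S) : (forall i, i != tau s0 -> v (b i) = 1) ->
    (forall s, P s -> s != s0) -> \prod_(s | P s) v (base_idx b s) = 1.
  by move=> v1' P0; apply: big1 => s /P0 ne; apply: v1'; apply: iso'.
have B1 i : i != tau s0 -> v1 (b i) = 1 by move=> /b1[].
have B2 i : i != tau s0 -> v2 (b i) = 1 by move=> /b1[].
have B3 i : i != tau s0 -> v3 (b i) = 1 by move=> /b1[].
pose A j := c1 * v1 j + c2 * v2 j + c3 * v3 j.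
have OA j : pi j = tau s0 -> O (A j).
  move=> pj; have [+ _] := L _ (valid_set_slot vb pj).
  by rewrite !tens_set_slot !W1 // !mulr1.
have OB j k : pi j = tau s0 -> pi k != tau s0 ->
    O (c1 * v1 j * (v1 k - v3 k) + c2 * v2 j * (v2 k - v3 k)).
  move=> pj pk; have [s sk] := tau_surj (pi k).
  have ne : s0 != s by apply: contra pk => /eqP ->; rewrite sk.
  have vM : valid (set_slot (set_slot (base_idx b) s k) s0 j).
    by do 2!apply: valid_set_slot => //.
  have [+ _] := L _ vM; rewrite !tens_set_slot2 // !W1 //; try by move=> t /andP[].
  move=> OM; have := placeB pl OM (placeM pl (OA j pj) (O3 k)).
  by congr O; rewrite /A; ring.
(* Cramer's rule in the slot [s0]: the minor of [v1] and [v2] has nonzero reduction, so the two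
   terms of [OB] can be solved for. *)
have Oc c c' v v' : (c = c1 /\ v = v1 /\ c' = c2 /\ v' = v2) \/
    (c = c2 /\ v = v2 /\ c' = c1 /\ v' = v1) -> forall k, pi k != tau s0 ->
    O (c * (v k - v3 k)).
  move=> H k pk; set lam := _ - _ in nz.
  have Olam : O lam by apply: (placeB pl); apply: (placeM pl).
  have nzl : lam != 0.
    by apply: contraNneq nz => ->; case: (spec0 pl) => _ ->.
  have [OV _] := specV pl (spec_res res Olam) nz.
  have OB' j x : O x -> pi j = tau s0 ->
      O (x * (c1 * v1 j * (v1 k - v3 k) + c2 * v2 j * (v2 k - v3 k))).
    by move=> Ox pj; apply: (placeM pl) => //; apply: OB.
  suff : O (c * (v k - v3 k) * lam).
    by move/(placeM pl)/(_ OV); rewrite mulfK.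
  case: H => [[-> [-> _]]|[-> [-> _]]].
    have := placeB pl (OB' j1 _ (O2 j2) pj1) (OB' j2 _ (O2 j1) pj2).
    by congr O; rewrite /lam; ring.
  have := placeB pl (OB' j2 _ (O1 j1) pj2) (OB' j1 _ (O1 j2) pj1).
  by congr O; rewrite /lam; ring.
have {}Oc1 k : pi k != tau s0 -> O (c1 * (v1 k - v3 k)).
  by apply: (Oc _ c2 _ v2); left.
have {Oc}Oc2 k : pi k != tau s0 -> O (c2 * (v2 k - v3 k)).
  by apply: (Oc _ c1 _ v1); right.
apply: rank_le_ext (rank_pencil pi (fun j => res (A j)) (res \o v1) (res \o v2)
  (res \o v3) (fun j => res (c1 * (v1 j - v3 j)))
  (fun j => res (c2 * (v2 j - v3 j))) iso) => M vM.
apply: (spec_uniq (L M vM)).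
have ne s : s != s0 -> pi (M s) != tau s0 by rewrite vM; apply: iso'.
have T c v : (forall k, pi k != tau s0 -> O (c * (v k - v3 k))) ->
   (forall k, pi k != tau s0 -> spec (v k - v3 k) 0) ->
   spec (c * (\prod_(s | s != s0) v (M s) - \prod_(s | s != s0) v3 (M s)))
    (\prod_(s | s != s0) lin (res (v3 (M s))) (res (c * (v (M s) - v3 (M s)))))`_1.
  move=> Oc mv.
  have := @spec_taylor1 _ _ _ _ pl _ (index_enum S) (fun s => s != s0) c
    (v3 \o M) (fun s => v (M s) - v3 (M s)) (fun s => res (v3 (M s)))
    (fun s => res (c * (v (M s) - v3 (M s)))).
  have -> : \prod_(s | s != s0) ((v3 \o M) s + (v (M s) - v3 (M s))) =
    \prod_(s | s != s0) v (M s) by apply: eq_bigr => s _ /=; ring.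
  apply=> s /ne pMs; split; [exact: spec_fresh | exact: mv | ].
  by apply: spec_res; apply: Oc.
have T1 := T _ _ Oc1 (fun k pk => (m k pk).1).
have T2 := T _ _ Oc2 (fun k pk => (m k pk).2).
have T3 : spec (\prod_(s | s != s0) v3 (M s)) (\prod_(s | s != s0) (res \o v3) (M s)).
  by apply: spec_prod => // s _; apply: spec_fresh.
have SA := spec_res res (OA (M s0) (vM s0)).
have S1 := spec_fresh O1 (M s0); have S2 := spec_fresh O2 (M s0).
apply: spec_eq (specD pl (specD pl (specM pl SA T3) (specM pl S1 T1))
  (specM pl S2 T2)) _ _.
  rewrite !(tens_isolated _ s0) /A; ring.
by [].
Qed.

Lemma rank_of_isolated_factor c1 v1 c2 v2 c3 v3 s0 :
  limit_of c1 v1 c2 v2 c3 v3 p -> primitive v1 -> primitive v2 -> primitive v3 ->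
  (forall s, tau s = tau s0 -> s = s0) -> separated (tau s0) v1 v2 ->
  (forall i, i != tau s0 -> ~ separated i v1 v2 /\ ~ separated i v1 v3) ->
  rank_le pi tau p (2 * D - 1).
Proof.
move=> L [O1 [b vb]] P2 P3 iso sep ns.
have [w2 [l2 [E2 Ow2 b2 m2 e2]]] := @rebase (fun i => i != tau s0) _ _ _ O1 vb P2
  (fun i ne => (ns i ne).1).
have [w3 [l3 [E3 Ow3 b3 m3 e3]]] := @rebase (fun i => i != tau s0) _ _ _ O1 vb P3
  (fun i ne => (ns i ne).2).
apply: (@rank_of_pencil c1 v1 (c2 * l2) w2 (c3 * l3) w3 s0 b) => //.
- by move=> M vM; have := L M vM; rewrite E2 // E3 // !mulrA.
- have [j [j' [pj pj' nz]]] := sep; exists j, j'; split=> //.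
  by rewrite !e2 // ?pj ?pj' negbK.
- by move=> i; case: (vb i).
- by move=> i ne; split; [case: (vb i) | exact: b2 | exact: b3].
- move=> j ne; have H3 := specN pl (m3 j ne); split.
    by apply: (spec_eq H3); [ring | rewrite oppr0].
  by apply: (spec_eq (specD pl (m2 j ne) H3)); [ring | rewrite oppr0 addr0].
Qed.

(** The third term is integral and can be subtracted. With [d] the rescaled [c2], the test
    coordinates then show [c1 + d] and [d * (w - v1)] integral, which yields a tangent vector at the
    reduction of [v1]. *)
Lemma rank_of_tangent_point c1 v1 c2 v2 c3 v3 :
  limit_of c1 v1 c2 v2 c3 v3 p -> primitive v1 -> primitive v2 -> integral v3 ->
  (forall i, ~ separated i v1 v2) -> O c3 -> rank_le pi tau p (2 * D - 1).
Proof.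
move=> L [O1 [b vb]] P2 O3 ns Oc3.
have [w [l [E Ow bw mw _]]] := @rebase predT _ _ _ O1 vb P2 (fun i _ => ns i).
have wb : based w b by move=> i; split; [case: (vb i) | exact: bw].
have T (v : J -> F) (M : S -> J) : integral v -> spec (tens v M) (tens (res \o v) M).
  by move=> Ov; apply: spec_prod => // s _; apply: spec_fresh.
pose d := c2 * l.
have OL M : valid M -> O (c1 * tens v1 M + d * tens w M).
  move=> vM; have [OM _] := L M vM; have [OT _] := T v3 M O3.
  have := placeB pl OM (placeM pl Oc3 OT); rewrite E //.
  by congr O; rewrite /d; ring.
have OC : O (c1 + d).
  have := OL _ (base_valid vb); rewrite (tens_base vb) (tens_base wb).
  by rewrite !mulr1.
have Od j : O (d * (w j - v1 j)).
  have [s sj] := tau_surj (pi j).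
  have := OL _ (valid_set_slot (base_valid vb) (esym sj)).
  rewrite (tens_base1 _ _ vb) (tens_base1 _ _ wb) => OM.
  have := placeB pl OM (placeM pl OC (O1 j)).
  by congr O; ring.
have pE M : valid M -> p M = res (c1 + d) * tens (res \o v1) M +
    (tens (line_pt (res \o v1) (fun j => res (d * (w j - v1 j)))) M)`_1 +
    res c3 * tens (res \o v3) M.
  move=> vM; apply: (spec_uniq (L M vM)).
  have T1 := @spec_taylor1 _ _ _ _ pl _ (index_enum S) predT d
    (v1 \o M) (fun s => w (M s) - v1 (M s)) (fun s => res (v1 (M s)))
    (fun s => res (d * (w (M s) - v1 (M s)))).
  have {}T1 := T1 (fun s _ => And3 (spec_fresh O1 (M s)) (mw (M s) isT)
    (spec_res res (Od (M s)))).
  apply: spec_eq (specD pl (specD pl (specM pl (spec_res res OC) (T v1 M O1)) T1)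
    (specM pl (spec_res res Oc3) (T v3 M O3))) _ _ => //.
  rewrite E //= (eq_bigr (fun s => w (M s))); last by move=> s _; ring.
  by rewrite /d /tens; ring.
have [D3|D3] := leqP 3 D.
  apply: (@rank_leW _ _ _ _ _ _ _ D.+2); first by lia.
  by apply: (rank_le_ext pE); exact: rank_tangent_point.
have D2' : D = 2 by lia.
by rewrite D2'; apply: (rank_le_ext pE); exact: rank_two_slots.
Qed.

(** The divided-difference expansion has coefficients [C], [g], [h], [sg]. Test coordinates show
    [C], [g], [sg] integral, those at [m0] and [m1] telling [g] from [sg]. If [h] is integral, the
    limit is a functional of order at most two. If not, integrality of [h * (u j * u j')] makes [u]
    reduce to 0 outside one factor of degree one, and a pencil results. *)
Lemma rank_of_second_order c1 c2 c3 v u r b d e rho m0 m1 :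
  limit_of c1 v c2 (fun j => v j + d * u j)
           c3 (fun j => v j + e * u j + rho * r j) p ->
  integral v -> integral u -> integral r -> based v b ->
  (forall i, u (b i) = 0 /\ r (b i) = 0) ->
  u m0 = 1 -> r m0 = 0 -> (rho = 0 \/ r m1 = 1) ->
  spec d 0 -> spec e 0 -> spec rho 0 -> rank_le pi tau p (2 * D - 1).
Proof.
set v2 := fun j => v j + d * u j; set v3 := fun j => v j + e * u j + rho * r j.
move=> L Ov Ou Or vb ur0 um0 rm0 rm1 Sd Se Srho.
have b2 : based v2 b.
  by move=> i; have [? vi] := vb i; have [ui _] := ur0 i; rewrite /v2 vi ui mulr0 addr0.
have b3 : based v3 b.
  move=> i; have [? vi] := vb i; have [ui ri] := ur0 i.
  by rewrite /v3 vi ui ri !mulr0 !addr0.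
pose C := c1 + c2 + c3; pose g := c2 * d + c3 * e.
pose h := c3 * (e * (e - d)); pose sg := c3 * rho.
have OD x y : O x -> O y -> O (x + y).
  by move=> Ox Oy; case: (specD pl (spec_res res Ox) (spec_res res Oy)).
have Od := spec_O Sd; have Oe := spec_O Se; have Orho := spec_O Srho.
have OC : O C.
  have [+ _] := L _ (base_valid vb).
  by rewrite (tens_base vb) (tens_base b2) (tens_base b3) !mulr1.
have Olin j : O (g * u j + sg * r j).
  have [s sj] := tau_surj (pi j).
  have [+ _] := L _ (valid_set_slot (base_valid vb) (esym sj)).
  rewrite (tens_base1 _ _ vb) (tens_base1 _ _ b2) (tens_base1 _ _ b3) => OM.
  have := placeB pl OM (placeM pl OC (Ov j)).
  by congr O; rewrite /C /g /sg /v2 /v3; ring.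
have Og : O g by have := Olin m0; rewrite um0 rm0 mulr1 mulr0 addr0.
have Osg : O sg.
  have [rho0|rm] := rm1; first by rewrite /sg rho0 mulr0; case: (spec0 pl).
  have := placeB pl (Olin m1) (placeM pl Og (Ou m1)).
  by rewrite rm mulr1; congr O; ring.
have Oquad s s' j j' : s != s' -> pi j = tau s -> pi j' = tau s' ->
    O (h * (u j * u j')).
  move=> ne pj pj'.
  have vM : valid (set_slot (set_slot (base_idx b) s' j') s j).
    by do 2!apply: valid_set_slot => //; exact: base_valid vb.
  have [+ _] := L _ vM.
  rewrite (tens_base2 _ _ vb) // (tens_base2 _ _ b2) // (tens_base2 _ _ b3) // => OM.
  have OR : O (C * (v j * v j') + g * (v j * u j' + u j * v j' + d * (u j * u j'))
      + sg * (v j * r j' + r j * v j' + e * (u j * r j' + r j * u j')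
      + rho * (r j * r j'))).
    repeat first [assumption | exact: (Ou _) | exact: (Ov _) | exact: (Or _)
      | apply: (placeM pl) | apply: (OD _ _)].
  have := placeB pl OM OR.
  by congr O; rewrite /C /g /sg /h /v2 /v3; ring.
have Sv := spec_fresh Ov; have Su := spec_fresh Ou; have Sr := spec_fresh Or.
have [Oh|nOh] := pselect (O h).
  pose V := res \o v; pose U := res \o u; pose R := res \o r.
  have pE M : valid M -> p M = res C * (tens (line_pt V U) M)`_0
      + res g * (tens (line_pt V U) M)`_1 + res h * (tens (line_pt V U) M)`_2
      + res sg * (tens (line_pt V R) M)`_1.
    move=> vM; apply: (spec_uniq (L M vM)).
    have [|x [y [z [w [J1 Sx Sy Sz Sw]]]]] := @jet_prod _ _ _ _ pl _ (index_enum S)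
      predT _ _ _ Sd Se Srho (v \o M) (u \o M) (r \o M) (V \o M) (U \o M) (R \o M).
      by move=> s _; split; [exact: Sv | exact: Su | exact: Sr].
    rewrite (jet_sum c1 c2 c3 J1).
    by do !apply: specD => //; apply: specM => //; apply: spec_res.
  have E0 M : (tens (line_pt V U) M)`_0 = tens V M.
    rewrite -horner_coef0 tens_horner; apply: eq_bigr => s _.
    by rewrite horner_line_pt mulr0 addr0.
  have ER M : res g * (tens (line_pt V U) M)`_1 + res sg * (tens (line_pt V R) M)`_1
      = (tens (line_pt V (fun j => res g * U j + res sg * R j)) M)`_1.
    by rewrite /tens -coef1_prod_linear.
  (* If [h] reduces to 0, only a tangent vector remains; otherwise, for [D] at least 3, dividing by
     [res h] absorbs the direction [R] into the conic. *)
  have [h0|nzh] := eqVneq (res h) 0.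
    apply: (@rank_leW _ _ _ _ _ _ _ D.+1); first by lia.
    apply: rank_le_ext (rank_tangent pi tau (res C) V
      (fun j => res g * U j + res sg * R j)) => M vM.
    by rewrite pE // h0 mul0r addr0 -addrA ER E0.
  have [D3|D3] := leqP 3 D.
    apply: rank_le_ext (rank_conic pi tau (res C) (res g) V U
      (fun j => res sg / res h * R j) nzh D3) => M vM.
    have [[-> -> ->] _] := coef_prod_conic (index_enum S) predT (V \o M) (U \o M)
      (R \o M) (res sg / res h).
    by rewrite pE // mulrDr addrA mulrA mulrCA divff // mulr1.
  have D2' : D = 2 by lia.
  rewrite D2'; apply: rank_le_ext (rank_two_slots pi tau (res C) V
    (fun j => res g * U j + res sg * R j) (res h) U D2') => M vM.
  have -> : tens U M = (tens (line_pt V U) M)`_2.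
    have szS : size (index_enum S) = 2 by rewrite [index_enum S]unlock -enumT -cardT.
    have := coef_top_prod_lin (index_enum S) (V \o M) (U \o M).
    by rewrite szS => ->.
  by rewrite pE // -ER E0; ring.
have [s0 s0m] := tau_surj (pi m0).
(* A second slot in the factor of [m0] would allow [j = j' = m0] and make [h] integral. *)
have iso s : tau s = tau s0 -> s = s0.
  move=> ss0; apply: contrapT => /eqP ne; apply: nOh.
  by have := Oquad _ _ m0 m0 ne; rewrite um0 !mulr1; apply; rewrite ?ss0 s0m.
have Ohu j : pi j != tau s0 -> O (h * u j).
  move=> pj; have [s sj] := tau_surj (pi j).
  have ne : s0 != s by apply: contra pj => /eqP ->; rewrite sj.
  by have := Oquad _ _ m0 j ne; rewrite um0 mul1r; apply; rewrite ?s0m ?sj.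
have Su0 j : pi j != tau s0 -> spec (u j) 0.
  move=> /Ohu Oj; have := specM pl (spec_notO pl nOh) (spec_res res Oj).
  have nzh : h != 0 by apply/eqP => h0; apply: nOh; rewrite h0; case: (spec0 pl).
  by rewrite mulrA mulVf // mul1r mul0r.
apply: rank_le_ext (rank_pencil pi (fun j => res C * res (v j) + res g * res (u j)
    + res sg * res (r j)) (res \o v) (res \o u) (res \o v)
  (fun j => res sg * res (r j)) (fun j => res (h * u j)) iso) => M vM.
apply: (spec_uniq (L M vM)).
have ne s : s != s0 -> pi (M s) != tau s0.
  by move=> ss0; rewrite vM; apply: contra ss0 => /eqP /iso ->.
have [|x [y [z [w [J1 Sx [Sy Shy] [Sz Shz] Sw]]]]] :=
  @jet_prod_slow _ _ _ _ pl _ (index_enum S) (fun s => s != s0) _ _ _ Sd Se Srho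
   (v \o M) (u \o M) (r \o M) (res \o v \o M) (res \o r \o M) h
   (fun s => res (h * u (M s))).
  move=> s /ne pMs; split; [exact: Sv | exact: Su0 | exact: Sr |].
  by apply: spec_res; apply: Ohu.
have J0 : jet d e rho (v (M s0)) (v2 (M s0)) (v3 (M s0))
    (v (M s0)) (u (M s0)) 0 (r (M s0)).
  by split; rewrite /v2 /v3; ring.
rewrite !(tens_isolated _ s0) (jet_sum c1 c2 c3 (jetM J0 J1)) -/C -/g -/h -/sg.
have SC := spec_res res OC; have Sg := spec_res res Og; have Ssg := spec_res res Osg.
have Sv0 := Sv (M s0); have Su0' := Su (M s0); have Sr0 := Sr (M s0).
have lin0 :
    (\prod_(s | s != s0) line_pt (res \o v) (fun j => res sg * res (r j)) (M s))`_1
    = res sg * (\prod_(s | s != s0) line_pt (res \o v) (res \o r) (M s))`_1.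
  have := coef1_prod_linear (index_enum S) (fun s => s != s0) (res \o v \o M)
    (res \o r \o M) (res \o r \o M) (res sg) 0.
  rewrite mul0r addr0 => <-; congr ((polyseq _)`_1); apply: eq_bigr => s _.
  by rewrite mul0r addr0.
rewrite lin0.
have P1 := specM pl SC (specM pl Sv0 Sx).
have P2 := specM pl Sg (specD pl (specD pl (specM pl Sv0 Sy) (specM pl Su0' Sx))
  (specM pl (specM pl Sd Su0') Sy)).
have P3 := specD pl (specD pl (specM pl Sv0 Shz) (specM pl Su0' Shy))
  (specM pl Se (specM pl Su0' Shz)).
have P4 := specM pl Ssg (specD pl (specD pl (specM pl Sv0 Sw) (specM pl Sr0 Sx))
  (specD pl (specM pl Se (specD pl (specM pl Su0' Sw) (specM pl Sr0 Sy)))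
  (specD pl (specM pl (specM pl Se (specB pl Se Sd)) (specM pl Sr0 Sz))
            (specM pl Srho (specM pl Sr0 Sw))))).
apply: spec_eq (specD pl (specD pl (specD pl P1 P2) P3) P4) _ _.
  by ring.
rewrite /=; ring.
Qed.

(** Gram-Schmidt over a valuation ring gives the shape [v], [v + d u], [v + e u + rho r]: among the
    coordinates of the two differences, [d] divides all, and [rho] does so for what remains of the
    second difference once its [u] component is removed. *)
Lemma rank_of_coalescing c1 v1 c2 v2 c3 v3 :
  limit_of c1 v1 c2 v2 c3 v3 p -> primitive v1 -> primitive v2 -> primitive v3 ->
  (forall i, ~ separated i v1 v2) -> (forall i, ~ separated i v1 v3) ->
  rank_le pi tau p (2 * D - 1).
Proof.
move=> L [Ov [b vb]] P2 P3 ns2 ns3.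
have [w2 [l2 [E2 Ow2 bw2 m2 _]]] := @rebase predT _ _ _ Ov vb P2 (fun i _ => ns2 i).
have [w3 [l3 [E3 Ow3 bw3 m3 _]]] := @rebase predT _ _ _ Ov vb P3 (fun i _ => ns3 i).
have {}L : limit_of c1 v1 (c2 * l2) w2 (c3 * l3) w3 p.
  by move=> M vM; have := L M vM; rewrite E2 // E3 // !mulrA.
move: (c2 * l2) (c3 * l3) L {E2 E3 P2 P3 ns2 ns3} => {}c2 {}c3 L.
have [[j0]|allE] := pselect (exists j : J, True); last first.
  exfalso; have s0 : S by apply/(fun h => enum_val (Ordinal h)); exact: ltnW D2.
  by apply: allE; exists (b (tau s0)).
pose f (x : bool * J) := (if x.1 then w2 x.2 else w3 x.2) - v1 x.2.
have [[k m0] _ /= kmax] := @spec_max _ _ _ _ pl _ predT f (true, j0) isT.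
(* The two differences are exchanged if the dividing coordinate comes from [w3]. *)
move=> _; wlog k1 : c2 c3 w2 w3 L Ow2 Ow3 bw2 bw3 m2 m3 k @f kmax / k = true.
  move=> W; case: k @f kmax => f kmax; first exact: (W c2 c3 w2 w3 _ _ _ _ _ _ _ true).
  apply: (W c3 c2 w3 w2 _ _ _ _ _ _ _ true) => //; first exact: limit_swap23.
  by move=> [k j] _; have := kmax (~~ k, j) isT; case: k.
rewrite {k}k1 /f /= in kmax.
set d := w2 m0 - v1 m0 in kmax.
have div2 j : exists2 t, O t & w2 j - v1 j = t * d by exact: (kmax (true, j) isT).
have div3 j : exists2 t, O t & w3 j - v1 j = t * d by exact: (kmax (false, j) isT).
have Sd : spec d 0 by apply: m2.
have [d0|nzd] := eqVneq d 0.
  have e2 : w2 = v1.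
    by apply/funext => j; have [t _ /eqP] := div2 j; rewrite d0 mulr0 subr_eq0 => /eqP.
  have e3 : w3 = v1.
    by apply/funext => j; have [t _ /eqP] := div3 j; rewrite d0 mulr0 subr_eq0 => /eqP.
  have OC : O (c1 + c2 + c3).
    have [+ _] := L _ (base_valid vb).
    by rewrite e2 e3 (tens_base vb) !mulr1.
  have S0 := spec0 pl.
  apply: (@rank_of_integral_coefs (c1 + c2 + c3) v1 0 v1 0 v1) => //;
    try by case: S0.
  move=> M vM; have := L M vM; rewrite e2 e3 => SM.
  by apply: (spec_eq SM) => //; ring.
pose u j := (w2 j - v1 j) / d.
have Ou : integral u by move=> j; rewrite /u; have [t Ot ->] := div2 j; rewrite mulfK.
have um0 : u m0 = 1 by rewrite /u -/d divff.
pose e := w3 m0 - v1 m0.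
pose Z j := w3 j - v1 j - e * u j.
have divZ j : exists2 t, O t & Z j = t * d.
  have [t Ot tE] := div3 j; have [t0 Ot0 t0E] := div3 m0.
  exists (t - t0 * u j); first by apply: (placeB pl) => //; apply: (placeM pl).
  by rewrite /Z tE /e t0E; ring.
have [m1 _ m1max] := @spec_max _ _ _ _ pl J predT Z m0 isT.
set rho := Z m1 in m1max.
pose r j := if rho == 0 then 0 else Z j / rho.
have rE j : rho * r j = Z j.
  rewrite /r; case: eqP => [r0|/eqP nz]; last by rewrite mulrC divfK.
  by have [t _] := m1max j isT; rewrite r0 !mulr0.
have Or : integral r.
  move=> j; rewrite /r; case: eqP => [_|/eqP nz]; first by case: (spec0 pl).
  by have [t Ot ->] := m1max j isT; rewrite mulfK.
have Zm0 : Z m0 = 0 by rewrite /Z um0 mulr1 subrr.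
have rm0 : r m0 = 0 by rewrite /r Zm0 mul0r if_same.
have base0 i : [/\ w2 (b i) - v1 (b i) = 0 & w3 (b i) - v1 (b i) = 0].
  by have [_ ->] := vb i; rewrite bw2 // bw3 // subrr.
have Srho : spec rho 0.
  have [t Ot tE] := divZ m1; rewrite /rho tE.
  by apply: spec_val (specM pl (spec_res res Ot) Sd) _; rewrite mulr0.
apply: (@rank_of_second_order c1 c2 c3 v1 u r b d e rho m0 m1) => //.
- move=> M vM; apply: (spec_eq (L M vM)) => //; congr (_ + _ * _ + _ * _).
    by apply: eq_bigr => s _; rewrite /u mulrC divfK //; ring.
  by apply: eq_bigr => s _; rewrite rE /Z; ring.
- move=> i; have [z2 z3] := base0 i; rewrite /u z2 mul0r; split=> //.
  by rewrite /r /Z z3 /u z2 mul0r mulr0 subrr mul0r if_same.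
- have [r0|nz] := eqVneq rho 0; first by left.
  by right; rewrite /r (negbTE nz) divff.
- exact: m3.
Qed.

Lemma rank_of_limit c1 v1 c2 v2 c3 v3 :
  limit_of c1 v1 c2 v2 c3 v3 p -> primitive v1 -> primitive v2 -> primitive v3 ->
  rank_le pi tau p (2 * D - 1).
Proof.
move=> L P1 P2 P3; apply: contrapT => notrank.
pose same v w := forall i, ~ separated i v w.
have sameC v w : same v w -> same w v by move=> vw i /separatedC; apply: vw.
have sepE v w : ~ same v w -> exists s, separated (tau s) v w.
  move=> ns; apply: contrapT => no; apply: ns => i sep; apply: no.
  by have [s si] := tau_surj i; exists s; rewrite si.
(* A point whose reduction differs from both others has an integral coefficient unless all its
   separations occur in one slot; that slot is then alone in its factor and gives the pencil
   case. *)
have key d1 w1 d2 w2 d3 w3 : limit_of d1 w1 d2 w2 d3 w3 p ->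
    primitive w1 -> primitive w2 -> primitive w3 ->
    [\/ O d1, same w1 w2 | same w1 w3].
  move=> L' Q1 Q2 Q3.
  have [?|/sepE[s sep]] := pselect (same w1 w2); first by constructor 2.
  have [?|/sepE[s' sep']] := pselect (same w1 w3); first by constructor 3.
  have coef t t' : separated (tau t) w1 w2 -> separated (tau t') w1 w3 ->
      t != t' -> O d1.
    by move=> ? ? ?; apply: (coef_integral L' Q1 Q2.1 Q3.1 (s := t) (s' := t')).
  have [Od1|nO] := pselect (O d1); first by constructor 1.
  have eqt t t' : separated (tau t) w1 w2 -> separated (tau t') w1 w3 -> t = t'.
    by move=> h h'; apply: contrapT => /eqP /(coef _ _ h h').
  case: notrank; have ss' := eqt _ _ sep sep'; rewrite -ss' in sep'.
  apply: (rank_of_isolated_factor L' Q1 Q2 Q3 (s0 := s)) => //.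
    by move=> t ts; apply: eqt; rewrite ?ts.
  move=> i ne; have [t ti] := tau_surj i; rewrite -ti in ne *.
  split=> sepi; case/eqP: ne; congr tau; first exact: eqt.
  by apply: esym; apply: eqt.
(* When two reductions coincide, either the third coefficient is integral or the third reduction
   coincides with them as well. *)
have two d1 w1 d2 w2 d3 w3 : limit_of d1 w1 d2 w2 d3 w3 p ->
    primitive w1 -> primitive w2 -> primitive w3 -> ~ same w1 w2.
  move=> L' Q1 Q2 Q3 s12; apply: notrank.
  have L3 : limit_of d3 w3 d1 w1 d2 w2 p.
    by apply: limit_swap12; apply: limit_swap23.
  have [Od3|s31|s32] := key _ _ _ _ _ _ L3 Q3 Q1 Q2.
  - exact: (rank_of_tangent_point L' Q1 Q2 Q3.1 s12 Od3).
  - exact: (rank_of_coalescing L' Q1 Q2 Q3 s12 (sameC _ _ s31)).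
  - exact: (rank_of_coalescing (limit_swap12 L') Q2 Q1 Q3 (sameC _ _ s12)
      (sameC _ _ s32)).
have L2 := limit_swap12 L; have L13 := limit_swap23 L.
have L3 := limit_swap12 L13.
have n12 := two _ _ _ _ _ _ L P1 P2 P3.
have n13 := two _ _ _ _ _ _ L13 P1 P3 P2.
have n23 := two _ _ _ _ _ _ (limit_swap23 L2) P2 P3 P1.
apply: notrank; apply: (rank_of_integral_coefs L P1.1 P2.1 P3.1).
- by case: (key _ _ _ _ _ _ L P1 P2 P3).
- by case: (key _ _ _ _ _ _ L2 P2 P1 P3) => // /sameC.
- by case: (key _ _ _ _ _ _ L3 P3 P1 P2) => // /sameC.
Qed.

End Limits.

(** * Segre-Veronese coordinates *)

Section Monomials.
Variables (k : nat) (n d : 'I_k -> nat).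

Definition slot := {i : 'I_k & 'I_(d i)}.
Definition coord := {i : 'I_k & 'I_(n i).+1}.
Local Notation valid := (@valid 'I_k coord slot tag tag).

Lemma card_slot : #|{: slot}| = (\sum_(i < k) d i)%N.
Proof.
rewrite card_tagged sumnE big_map big_enum.
by apply: eq_bigr => i _; rewrite card_ord.
Qed.

Definition monomial_eval (R : comNzRingType) (v : coord -> R) (a : SVidx n d) : R :=
  \prod_(i < k) \prod_(j < (n i).+1) v (Tagged _ j) ^+ (val (a i) j : nat).

Lemma tens_fibers (R : comNzRingType) (v : coord -> R) (M : slot -> coord) :
  tens v M = \prod_(i < k) \prod_(l < d i) v (M (Tagged _ l)).
Proof.
rewrite (sig_big_dep xpredT (fun i => xpredT)
  (fun i (l : 'I_(d i)) => v (M (Tagged _ l)))).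
by apply: eq_bigr => -[i l].
Qed.

Lemma prod_card_fibers (R : comNzRingType) (T U : finType) (m : T -> U) (f : U -> R) :
  \prod_l f (m l) = \prod_j f j ^+ #|[pred l | m l == j]|.
Proof.
rewrite (partition_big m predT) //=; apply: eq_bigr => j _.
by rewrite -prodr_const; apply: eq_bigr => l /eqP ->.
Qed.

Lemma monomial_of_slots (M : slot -> coord) : valid M ->
  exists a : SVidx n d, forall (R : comNzRingType) (v : coord -> R),
    tens v M = monomial_eval v a.
Proof.
move=> vM.
have H s : {j : 'I_(n (tag s)).+1 | M s = Tagged _ j}.
  case: (M s) (vM s) => i j /= e; move: j; rewrite e => j; by exists j.
pose m i (l : 'I_(d i)) : 'I_(n i).+1 := sval (H (Tagged _ l)).
pose f i : {ffun 'I_(n i).+1 -> 'I_(d i).+1} :=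
  [ffun j => inord #|[pred l | m i l == j]|].
have fE i j : f i j = #|[pred l | m i l == j]| :> nat.
  by rewrite ffunE inordK // ltnS -[X in (_ <= X)%N]card_ord max_card.
have fP i : (\sum_(j < (n i).+1) (f i j : nat))%N == d i.
  apply/eqP; rewrite -[RHS]card_ord -sum1_card (partition_big (m i) predT) //=.
  by apply: eq_bigr => j _; rewrite fE -sum1_card.
exists (finfun (fun i => exist _ (f i) (fP i) : mon (n i) (d i)) : SVidx n d).
move=> R v; rewrite tens_fibers /monomial_eval; apply: eq_bigr => i _.
rewrite ffunE /= (eq_bigr (fun l => v (Tagged (fun i => 'I_(n i).+1) (m i l)))).
  by rewrite (prod_card_fibers (m i) (fun j => v (Tagged (fun i => 'I_(n i).+1) j)));
    apply: eq_bigr => j _; rewrite fE.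
by move=> l _; rewrite /m; case: (H _) => j /= ->.
Qed.

Lemma slots_of_monomial (a : SVidx n d) : exists2 M : slot -> coord, valid M &
  forall (R : comNzRingType) (v : coord -> R), tens v M = monomial_eval v a.
Proof.
pose s i := flatten [seq nseq (val (a i) j) j | j <- index_enum 'I_(n i).+1].
have szs i : size (s i) = d i.
  rewrite -(eqP (valP (a i))) size_flatten /shape -map_comp sumnE big_map.
  by apply: eq_bigr => j _; rewrite /= size_nseq.
exists (fun t : slot =>
  Tagged (fun i => 'I_(n i).+1) (nth ord0 (s (tag t)) (nat_of_ord (tagged t)))) => // R v.
rewrite tens_fibers; apply: eq_bigr => i _ /=.
have -> : \prod_(l < d i) v (Tagged (fun i => 'I_(n i).+1) (nth ord0 (s i) l)) =
    \prod_(j <- s i) v (Tagged (fun i => 'I_(n i).+1) j).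
  by rewrite (big_nth ord0) szs big_mkord.
rewrite big_flatten big_map; apply: eq_bigr => j _.
by rewrite big_nseq -Monoid.iteropE.
Qed.

End Monomials.

(** With a single slot every tensor is a vector, that is, one term already; this settles total
    degree 1, where the bound is 1. *)
Lemma rank_one_slot (K : closedFieldType) (I : eqType) (J S : finType)
    (pi : J -> I) (tau : S -> I) (p : (S -> J) -> K) :
  #|S| = 1%N -> rank_le pi tau p 1.
Proof.
move=> /eqP/fintype1P[s sP].
apply: rank_le_ext (rank_le_tens pi tau 1 (fun j => p (fun=> j))) => M _.
rewrite mul1r (tens_isolated _ s) big_pred0 ?mulr1; last by move=> t; rewrite sP eqxx.
by congr p; apply/funext => t; rewrite (sP t).
Qed.

(** Points of X are nonzero in every factor, while [rank_le] allows any vector. As each [d i] is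
    positive, a vector vanishing on a factor has zero tensor; its term becomes coefficient 0 on the
    all-ones vector. *)
Lemma X_rank_le_of_rank_le (K : closedFieldType) (k : nat) (n d : 'I_k -> nat)
    (hd : forall i, (0 < d i)%N) (p : SVidx n d -> K) (q : (slot d -> coord n) -> K) b :
  (forall a, exists2 M, @valid _ (coord n) (slot d) tag tag M & p a = q M /\
     forall v : coord n -> K, tens v M = monomial_eval v a) ->
  @rank_le 'I_k (coord n) (slot d) tag tag K q b -> X_rank_le p b.
Proof.
move=> pq [r [szr rP]].
pose good (v : coord n -> K) := [forall i, exists t, v (Tagged _ (t : 'I_(n i).+1)) != 0].
pose x0 : K * (coord n -> K) := (0, fun=> 1).
pose x j := nth x0 r j.
exists (size r); split=> //.
exists (fun j => if good (x j).2 then (x j).1 else 0),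
  (fun j i t => if good (x j).2 then (x j).2 (Tagged _ t) else 1); split.
  move=> j i; case: (boolP (good (x j).2)) => [g|_].
    by have /existsP[t /eqP nz] := forallP g i; exists t.
  by exists ord0; apply/eqP; exact: oner_neq0.
apply/funext => a; have [M vM [-> ME]] := pq a.
rewrite rP // (big_nth x0) big_mkord; apply: eq_bigr => j _; rewrite -/(x j).
case: (boolP (good (x j).2)) => [_|bad]; first by rewrite ME.
rewrite mul0r; move: bad; rewrite /good negb_forall => /existsP[i].
rewrite negb_exists => /forallP zi.
pose s0 : slot d := Tagged (fun i => 'I_(d i)) (Ordinal (hd i)).
rewrite (tens_isolated _ s0); have := vM s0; case: (M _) => i' t /= e.
by move: t; rewrite e => t; have := zi t; rewrite negbK => /eqP ->; rewrite mul0r mulr0.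
Qed.

Theorem theorem1 (K : closedFieldType) (k : nat) (hk : (0 < k)%N)
  (n d : 'I_k -> nat) (hn : forall i, (0 < n i)%N) (hd : forall i, (0 < d i)%N)
  (p : SVidx n d -> K) (hp0 : exists a, p a <> 0)
  (hp : @secant_cone K k n d 3 p) :
  @X_rank_le K k n d p ((\sum_(i < k) 2 * d i) - 1)%N.
Proof.
have tau_surj i : exists s : slot d, tag s = i.
  by exists (Tagged (fun i => 'I_(d i)) (Ordinal (hd i))).
have pi_surj i : exists j : coord n, tag j = i.
  by exists (existT (fun i => 'I_(n i).+1) i ord0).
have [a0 _] := hp0.
(* [al] sends an index to its monomial, with [a0] as default on invalid indices. *)
have /choice[al alP] (M : slot d -> coord n) : exists a : SVidx n d,
    @valid _ (coord n) (slot d) tag tag M ->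
    forall (R : comNzRingType) (v : coord n -> R),
    tens v M = monomial_eval v a.
  have [vM|nv] := pselect (@valid _ (coord n) (slot d) tag tag M); last by exists a0.
  by have [a aP] := monomial_of_slots vM; exists a.
have [F [cl [O [res [[cl1 clD clM clE] pl coordP]]]]] := zariski_closure_place hp.
have cl_prod (T : finType) (g : T -> (SVidx n d -> K) -> K) :
    cl (fun x => \prod_t g t x) = \prod_t cl (g t).
  elim: (index_enum T) => [|t r IH].
    by rewrite big_nil -cl1; apply: clE => x _; rewrite big_nil.
  by rewrite big_cons -IH -clM; apply: clE => x _; rewrite big_cons.
pose Y := (('I_3 -> K) * ('I_3 -> coord n -> K))%type.
(* A decomposition is chosen for each sum of three points; its entries, as functions of the sum,
   have classes in [F], which form the three points over [F]. *)
have /choice[cv cvP] (x : SVidx n d -> K) : exists y : Y, span_of_pts 3 x ->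
    forall a, x a = \sum_(j < 3) y.1 j * monomial_eval (y.2 j) a.
  have [[c [v [_ ->]]]|nS] := pselect (span_of_pts 3 x); last first.
    by exists (fun=> 0, fun _ _ => 0).
  by exists (c, fun j t => v j (tag t) (tagged t)).
pose c j := cl (fun x => (cv x).1 j).
pose v j t := cl (fun x => (cv x).2 j t).
have clx M : @valid _ (coord n) (slot d) tag tag M ->
    cl (fun x => x (al M)) = \sum_(j < 3) c j * tens (v j) M.
  move=> vM; rewrite !big_ord_recl big_ord0 addr0 /c /v /tens -!cl_prod -!clM -!clD.
  apply: clE => x Sx; rewrite (cvP _ Sx) !big_ord_recl big_ord0 addr0.
  by rewrite -!alP.
pose q M := p (al M).
apply: (@X_rank_le_of_rank_le K k n d hd p q).
  move=> a; have [M vM ME] := slots_of_monomial a; exists M => //; split=> //.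
  (* [a] and [al M] have the same monomial, so these two coordinates agree on all sums of three
     points and have one class in [F]. *)
  rewrite /q -(coordP a).2 -(coordP (al M)).2; congr res; apply: clE => x Sx.
  by rewrite !(cvP _ Sx); apply: eq_bigr => j _; rewrite -ME alP.
rewrite -big_distrr /= -card_slot.
have [le1|D2] := leqP #|{: slot d}| 1.
  have D1 : #|{: slot d}| = 1%N.
    apply/eqP; rewrite eqn_leq le1; apply/card_gt0P.
    by exists (Tagged (fun i => 'I_(d i)) (Ordinal (hd (Ordinal hk)))).
  by rewrite D1; apply: rank_one_slot.
have L : @limit_of F K O res 'I_k (coord n) (slot d) tag tag
    (c ord0) (v ord0) (c (inord 1)) (v (inord 1)) (c (inord 2)) (v (inord 2)) q.
  move=> M vM; have [OM rM] := coordP (al M).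
  rewrite clx // !big_ord_recl big_ord0 addr0 addrA in OM rM.
  have e1 : inord 1 = lift ord0 ord0 :> 'I_3 by apply/val_inj; rewrite /= inordK.
  have e2 : inord 2 = lift ord0 (lift ord0 ord0) :> 'I_3.
    by apply/val_inj; rewrite /= inordK.
  by rewrite e1 e2; split.
have norm j := normalize pl tau_surj (c j) (v j) pi_surj.
have [c1 [v1 [P1 E1]]] := norm ord0.
have [c2 [v2 [P2 E2]]] := norm (inord 1).
have [c3 [v3 [P3 E3]]] := norm (inord 2).
apply: (@rank_of_limit _ _ _ _ pl _ _ _ tag tag tau_surj q D2 c1 v1 c2 v2 c3 v3) => //.
by move=> M vM; rewrite -E1 // -E2 // -E3 //; apply: L.
Qed.
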